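(* Let $U=(-a,a)$ for some $a>0$ and let $H:U\to\mathbb{R}$ be non-constant, even, and piecewise $C^1$ with (finite) set of kinks $\mathcal{K}$, with $Z_\beta=\int_U e^{-\beta H(x)}\,dx<\infty$ for all $\beta\geq 0$. If $H'(x)\geq 0$ for all $x\in(0,a)\setminus\mathcal{K}$, then the Poincaré constant $\alpha_\beta$ is a strictly decreasing function of $\beta\geq 0$. If $H'(x)\leq 0$ for all $x\in(0,a)\setminus\mathcal{K}$, then $\alpha_\beta$ is a strictly increasing function of $\beta\geq 0$.
   Context: For an interval $I\subset\mathbb{R}$, a function $H:I\to\mathbb{R}$ is piecewise $C^1$ if it is continuous and there is a finite set $\mathcal{K}\subset I$ (the kinks) such that $H|_{I\setminus\mathcal{K}}$ is continuously differentiable, and at the points of $\mathcal{K}$ the left- and right-sided derivatives exist. For $\beta\geq 0$, $\mu_\beta$ is the probability measure on $U$ with Lebesgue density $Z_\beta^{-1}e^{-\beta H(x)}$. $H^1(U,\mu_\beta)$ is the space of weakly differentiable $f:U\to\mathbb{R}$ with $f,f'\in L^2(U,\mu_\beta)$. The Poincaré constant $\alpha_\beta$ is the smallest constant such that $$\int_U f^2\,d\mu_\beta-\Big(\int_U f\,d\mu_\beta\Big)^2\leq\alpha_\beta\int_U|f'|^2\,d\mu_\beta\quad\text{for all }f\in H^1(U,\mu_\beta).$$ *)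

(* Defs.v *)
From HB Require Import structures.
From mathcomp Require Import all_boot all_order all_algebra.
From mathcomp Require Import all_classical all_reals all_analysis.
From mathcomp Require Import measurable_realfun.

Set Implicit Arguments.
Unset Strict Implicit.
Unset Printing Implicit Defensive.

Import Order.TTheory GRing.Theory Num.Theory.
Import numFieldNormedType.Exports.

Local Open Scope classical_set_scope.
Local Open Scope ring_scope.

(* Functions on an open set I are total functions R -> R of which only the
   values on I matter. *)

(* Meant for open I: then I minus K is open too, so the two-sided derivative
   derive1 H at its points depends on H only through its values on I. *)
Definition piecewise_C1 {R : realType} (I K : set R) (H : R -> R) : Prop :=
  [/\ {within I, continuous H},
      finite_set K /\ K `<=` I,
      (forall x, (I `\` K) x -> derivable H x 1),
      {within I `\` K, continuous (derive1 H)} &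
      forall x, K x ->
        cvg (h^-1 * (H (x + h) - H x) @[h --> 0^'-]) /\
        cvg (h^-1 * (H (x + h) - H x) @[h --> 0^'+])].

Definition partition_function {R : realType} (U : set R) (H : R -> R)
    (beta : R) : \bar R :=
  (\int[lebesgue_measure]_(x in U) (expR (- (beta * H x)))%:E)%E.

Definition gibbs_density {R : realType} (U : set R) (H : R -> R)
    (beta x : R) : R :=
  (fine (partition_function U H beta))^-1 * expR (- (beta * H x)).

(* The measure mu_beta. As a set function it lives on all of R and does not
   charge the complement of U. *)
Definition gibbs {R : realType} (U : set R) (H : R -> R) (beta : R) :
    set (measurableTypeR R) -> \bar R :=
  fun A => (\int[lebesgue_measure]_(x in U `&` A)
              (gibbs_density U H beta x)%:E)%E.

Definition square_integrable {R : realType}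
    (mu : set (measurableTypeR R) -> \bar R) (U : set R) (f : R -> R) : Prop :=
  measurable_fun U f /\ (\int[mu]_(x in U) (f x ^+ 2)%:E < +oo)%E.

(* Smooth functions with compact support in U. *)
Definition test_function {R : realType} (U : set R) (phi : R -> R) : Prop :=
  (forall n x, derivable (derive1n n phi) x 1) /\
  exists C : set R,
    [/\ compact C, C `<=` U & forall x, ~ C x -> phi x = 0].

Definition is_weak_derivative {R : realType} (U : set R) (f g : R -> R) : Prop :=
  [/\ locally_integrable U f, locally_integrable U g &
      forall phi, test_function U phi ->
        (\int[lebesgue_measure]_(x in U) (f x * derive1 phi x)%:E =
         - \int[lebesgue_measure]_(x in U) (g x * phi x)%:E)%E].

(* f belongs to H^1(U, mu), with weak derivative g. *)
Definition H1_with_derivative {R : realType} (U : set R)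
    (mu : set (measurableTypeR R) -> \bar R) (f g : R -> R) : Prop :=
  [/\ is_weak_derivative U f g, square_integrable mu U f &
      square_integrable mu U g].

Definition poincare_inequality {R : realType} (U : set R)
    (mu : set (measurableTypeR R) -> \bar R) (C : R) : Prop :=
  forall f g, H1_with_derivative U mu f g ->
    (\int[mu]_(x in U) (f x ^+ 2)%:E - (\int[mu]_(x in U) (f x)%:E) ^+ 2
     <= C%:E * \int[mu]_(x in U) (`|g x| ^+ 2)%:E)%E.

(* Equal to +oo when no constant is admissible; otherwise the infimum is
   attained, see poincare_constant_min. *)
Definition poincare_constant {R : realType} (U : set R) (H : R -> R)
    (beta : R) : \bar R :=
  ereal_inf [set C%:E | C in poincare_inequality U (gibbs U H beta)].

Lemma gibbs_density_ge0 {R : realType} (U : set R) (H : R -> R) (beta x : R) :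
  0 <= gibbs_density U H beta x.
Proof.
rewrite /gibbs_density mulr_ge0 ?expR_ge0 // invr_ge0.
by apply/fine_ge0/integral_ge0 => y _; rewrite lee_fin expR_ge0.
Qed.

Lemma gibbs_ge0 {R : realType} (U : set R) (H : R -> R) (beta : R) A :
  (0 <= gibbs U H beta A)%E.
Proof. by apply: integral_ge0 => x _; rewrite lee_fin gibbs_density_ge0. Qed.

Lemma gibbs_semi_sigma_additive {R : realType} (U : set R) (H : R -> R)
    (beta : R) :
  measurable U -> measurable_fun U H ->
  semi_sigma_additive (gibbs U H beta).
Proof.
move=> mU mH F mF tF mUF; rewrite /gibbs setI_bigcupr.
have mUFi i : measurable (U `&` F i) by apply: measurableI; [exact: mU|exact: mF].
have tUF : trivIset setT (fun i => U `&` F i).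
  exact: trivIset_setIl tF.
have md : measurable_fun U (gibbs_density U H beta).
  apply: measurable_funM; first exact: measurable_cst.
  apply: measurableT_comp => //; apply: measurableT_comp => //.
  by apply: measurable_funM => //; exact: measurable_cst.
have d0 x : (0 <= (gibbs_density U H beta x)%:E)%E.
  by rewrite lee_fin gibbs_density_ge0.
rewrite ge0_integral_bigcup //; last first.
  apply/measurable_EFinP; apply: measurable_funS md => //.
  by rewrite -setI_bigcupr; exact: subIsetl.
apply: is_cvg_ereal_nneg_natsum_cond => n _ _.
by apply: integral_ge0 => x _; exact: d0.
Qed.

Lemma gibbs_setT {R : realType} (U : set R) (H : R -> R) (beta : R) :
  measurable U -> measurable_fun U H ->
  (0 < partition_function U H beta < +oo)%E ->
  gibbs U H beta setT = 1%E.
Proof.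
move=> mU mH /andP[Z0 Zoo]; rewrite /gibbs setIT.
have Zfin : partition_function U H beta \is a fin_num.
  by rewrite ge0_fin_numE // ltW.
under eq_integral do rewrite /gibbs_density EFinM.
rewrite ge0_integralZl //.
- rewrite -/(partition_function U H beta) -{2}(fineK Zfin) -EFinM mulVf //.
  by rewrite gt_eqF // fine_gt0 // Z0 Zoo.
- apply/measurable_EFinP; apply: measurableT_comp => //.
  apply: measurableT_comp => //.
  by apply: measurable_funM => //; exact: measurable_cst.
- by rewrite lee_fin invr_ge0 fine_ge0 // ltW.
Qed.

Lemma gibbs_is_probability {R : realType} (U : set R) (H : R -> R)
    (beta : R) :
  measurable U -> measurable_fun U H ->
  (0 < partition_function U H beta < +oo)%E ->
  exists P : probability (measurableTypeR R) R, P = gibbs U H beta :> (set _ -> _).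
Proof.
move=> mU mH Z.
have g0 : gibbs U H beta set0 = 0%E by rewrite /gibbs setI0 integral_set0.
pose isM := isMeasure.Build _ _ _ (gibbs U H beta) g0
  (@gibbs_ge0 R U H beta) (@gibbs_semi_sigma_additive R U H beta mU mH).
pose M : {measure set (measurableTypeR R) -> \bar R} := HB.pack (gibbs U H beta) isM.
have MT : M setT = 1%E by exact: gibbs_setT.
pose isP := Measure_isProbability.Build _ _ _ M MT.
pose P : probability (measurableTypeR R) R := HB.pack (gibbs U H beta) isM isP.
by exists P.
Qed.

Lemma poincare_constant_min {R : realType} (U : set R) (H : R -> R)
    (beta c : R) :
  measurable U -> measurable_fun U H ->
  (0 < partition_function U H beta < +oo)%E ->
  poincare_constant U H beta = c%:E ->
  poincare_inequality U (gibbs U H beta) c /\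
  forall C, poincare_inequality U (gibbs U H beta) C -> c <= C.
Proof.
move=> mU mH Z ac; split; last first.
  by move=> C hC; rewrite -lee_fin -ac; apply: ereal_inf_lbound; exists C.
move=> f g fg; have [_ _ [mg goo]] := fg.
have [P PE] := gibbs_is_probability mU mH Z.
have gE : (\int[gibbs U H beta]_(x in U) (`|g x| ^+ 2)%:E =
           \int[gibbs U H beta]_(x in U) (g x ^+ 2)%:E)%E.
  by congr integral; apply/funext => x; rewrite real_normK ?num_real.
rewrite gE; set D := (X in (_ <= _ * X)%E).
have D0 : (0 <= D)%E.
  by rewrite /D -PE; apply: integral_ge0 => x _; rewrite lee_fin sqr_ge0.
have Dfin : D \is a fin_num by rewrite ge0_fin_numE.
have d0 : 0 <= fine D by rewrite fine_ge0.
apply/lee_addgt0Pr => e e0.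
have e'0 : 0 < e / (fine D + 1) by rewrite divr_gt0 // ltr_wpDl.
have : (ereal_inf [set C%:E | C in poincare_inequality U (gibbs U H beta)]
        < (c + e / (fine D + 1))%:E)%E.
  by rewrite -/(poincare_constant U H beta) ac lte_fin ltrDl.
move=> /ereal_inf_lt[_ [C hC <-]]; rewrite lte_fin => Cc.
apply: le_trans (hC _ _ fg) _; rewrite gE -/D -(fineK Dfin) -!EFinM -EFinD lee_fin.
apply: (@le_trans _ _ ((c + e / (fine D + 1)) * fine D)).
  by rewrite ler_wpM2r // ltW.
rewrite mulrDl lerD2l mulrAC ler_pdivrMr ?ltr_wpDl //.
by rewrite ler_wpM2l ?lerDl // ltW.
Qed.

(* Main.v *)
Require Import Defs.
From mathcomp Require Import all_boot all_order all_algebra.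
From mathcomp Require Import all_classical all_reals all_analysis.
From mathcomp Require Import measurable_realfun.
From mathcomp Require Import ring lra.

(** The Poincare constant of an even weight is a one-sided Hardy constant, and
    the latter reacts monotonically to multiplying the weight by a monotone
    factor.

    Write [w = exp (- beta H)], and for [g >= 0] on [(0, a)] let
    [F x = int_0^x g]. The Poincare inequality on [(-a, a)] with constant [C] is
    equivalent to the Hardy inequality
    [int_0^a F^2 w <= C int_0^a g^2 w]. If Hardy holds, then the variance of [f]
    is at most the integral of [(f - f 0)^2], and Hardy applies on each half
    ([poincare_of_hardy]); this uses that a weakly differentiable function is
    a.e. a primitive of its weak derivative ([weak_representation]), which comes
    from testing against smoothed indicators of intervals. Conversely, the odd
    extension of [F] has mean zero, so Poincare applied to it is Hardy for [F]
    ([hardy_of_poincare]). No eigenfunction is involved.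

    Passing from [beta] to [gamma] multiplies [w] by
    [m = exp (- (gamma - beta) H)]. When [(gamma - beta) H] is nondecreasing on
    [(0, a)], [m] is nonincreasing, and the goal is that the weight [w m] has a
    strictly smaller constant; both halves of the theorem are of this form. By
    the layer cake formula [m = int 1_(s < m) ds] it suffices to treat
    [w 1_(s < m)], whose support is an initial interval [J]. Hardy for [g 1_J]
    and the weight [w] gives Hardy for [g] and the weight [w 1_J], with a
    surplus: the truncated primitive stays constant to the right of [J], where
    the weight still charges it. Integrating in [s] gives
    [int F^2 w m + k (F t1)^2 <= A int g^2 w m] with [k > 0] as soon as [m]
    drops between [t1] and a later point ([hardy_gain]).

    This surplus is converted into a smaller constant without any compactness
    argument ([hardy_strict]). If [g] nearly attains [A] for the weight
    [v = w m], then [F t1] is small; as the form [A int g^2 v - int F^2 v] is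
    nonnegative, testing it along [g + s p] with [p v = 1] on [(0, t1)] shows
    that [F b] is small for every [b < a] ([hardy_perturb],
    [perturbation_bound]). On the other hand [F^2 v <= a D int g^2 v] pointwise
    for an integrable [D] ([primitive_sqr_le]), so the mass of [F^2 v] cannot
    escape to the endpoint [a] either, and [int F^2 v] would be small, which is
    absurd because [A > 0]. A suitable [D] exists because the weights are
    monotone on [(0, a)]: the constant 1 if they decrease, [v / v 0] if they
    increase. *)

Set Implicit Arguments.
Unset Strict Implicit.
Unset Printing Implicit Defensive.

Import Order.TTheory GRing.Theory Num.Theory.
Import numFieldNormedType.Exports.

Local Open Scope classical_set_scope.
Local Open Scope ring_scope.

(** * Smooth bumps and steps *)

(** The family is closed under differentiation, which is how the smoothness of
    [bump 1 0], that is of [exp (- 1 / (x (1 - x)))], is obtained. *)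
Definition bump {R : realType} (p : {poly R}) (k : nat) (x : R) : R :=
  if 0 < x < 1 then
    p.[x] * (x * (1 - x))^-1 ^+ k * expR (- (x * (1 - x))^-1)
  else 0.

(** Such an [f] vanishes at [x], and its difference quotients there are
    [O (y - x)]. *)
Lemma is_derive_quadratic_bound {R : realType} (f : R -> R) (C x : R) :
  (forall y, `|f y| <= C * (y - x) ^+ 2) -> is_derive x 1 f 0.
Proof.
move=> fC.
have fx : f x = 0.
  by apply/eqP; rewrite -normr_le0; have := fC x; rewrite subrr expr0n mulr0.
have C0 : 0 <= C.
  by have := fC (x + 1); rewrite addrAC subrr add0r expr1n mulr1; apply: le_trans.
have H : h^-1 *: (f (h *: 1 + x) - f x) @[h --> 0^'] --> (0 : R).
  apply/cvgrPdist_le => e e0; near=> h.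
  have h0 : h != 0 by near: h; exact: nbhs_dnbhs_neq.
  rewrite sub0r normrN fx subr0 normrM normfV /=.
  rewrite mulrC ler_pdivrMr ?normr_gt0 //.
  apply: le_trans (fC _) _.
  rewrite /GRing.scale /= mulr1 addrK -(real_normK (num_real h)).
  rewrite expr2 mulrA ler_wpM2r //.
  have : `|h| <= e / (C + 1).
    near: h; apply: dnbhs0_le; by rewrite divr_gt0 // ltr_wpDl.
  rewrite ler_pdivlMr ?ltr_wpDl // mulrDr mulr1 mulrC => H.
  by apply: le_trans H; rewrite lerDl.
apply: DeriveDef; first by apply/cvg_ex; exists 0.
exact/cvg_lim.
Unshelve. all: by end_near. Qed.

(** Flatness of [exp (- 1 / v)] at [v = 0], where [v = y (1 - y)] is at most the
    distance from [y] to any point outside [(0, 1)]. It settles the derivative at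
    0, at 1 and outside [[0, 1]] at once. *)
Lemma bump_quadratic_bound {R : realType} (p : {poly R}) (k : nat) :
  exists C, forall x y, ~~ (0 < x < 1) ->
    `|bump p k y| <= C * (y - x) ^+ 2.
Proof.
have cp : {within `[0, 1], continuous (fun x => `|p.[x]|)}.
  apply: continuous_subspaceT => x.
  by apply: cvg_norm; exact: continuous_horner.
have [c _ cM] := EVT_max ler01 cp.
exists (`|p.[c]| * (k.+2)`!%:R) => x y x01.
rewrite /bump; case: ifPn => [/andP[y0 y1]|_]; last first.
  by rewrite normr0 mulr_ge0 ?sqr_ge0 ?mulr_ge0.
set v := y * (1 - y).
have v0 : 0 < v by rewrite mulr_gt0 // subr_gt0.
have vxy : v ^+ 2 <= (y - x) ^+ 2.
  rewrite -(real_normK (num_real (y - x))) lerXn2r ?nnegrE ?(ltW v0) ?normr_ge0 //.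
  move: x01; rewrite negb_and -!leNgt => /orP[x0|x1].
    rewrite ger0_norm; last by lra.
    rewrite /v; nra.
  rewrite ler0_norm; last by lra.
  rewrite /v; nra.
rewrite !normrM -[leRHS]mulrA -mulrA ler_pM //.
  by apply: cM; rewrite in_itv /= !ltW.
rewrite normrX gtr0_norm ?invr_gt0 // gtr0_norm ?expR_gt0 //.
apply: le_trans (_ : k.+2`!%:R * v ^+ 2 <= _); last by rewrite ler_wpM2l.
rewrite expRN -ler_pdivlMr ?invr_gt0 ?expR_gt0 // invrK.
have u0 : 0 <= v^-1 by rewrite invr_ge0 ltW.
(* with u = 1 / v: u^(k+2) / (k+2)! <= exp u, so u^k exp (- u) <= (k+2)! v^2 *)
have := expR_ge1Dxn k.+1 u0.
move=> /(le_trans (ler_wpDl ler01 (lexx _))).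
have : 0 < k.+2`!%:R :> R by rewrite ltr0n fact_gt0.
move: (k.+2`!%:R) => N N0; rewrite ler_pdivrMr // => H.
apply: le_trans (_ : v ^+ 2 * (expR v^-1 * N) <= _); last by rewrite le_eqVlt; apply/orP; left; apply/eqP; ring.
rewrite -(@ler_pM2l _ (v ^+ 2)) ?exprn_gt0 // in H.
apply: le_trans H.
rewrite -(addn2 k) exprD mulrCA -exprMn mulfV ?gt_eqF // expr1n mulr1.
by [].
Qed.

Lemma is_derive_bump {R : realType} (p : {poly R}) (k : nat) (x : R) :
  let v := 'X * (1 - 'X) : {poly R} in
  is_derive x 1 (bump p k)
    (bump (p^`() * v ^+ 2 - (p * v * v^`()) *+ k + p * v^`()) k.+2 x).
Proof.
move=> v; have [/andP[x0 x1]|x01] := boolP (0 < x < 1); last first.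
  have [C HC] := bump_quadratic_bound p k.
  by rewrite {2}/bump (negbTE x01); apply: (is_derive_quadratic_bound (HC x ^~ x01)).
have vE y : v.[y] = y * (1 - y) by rewrite /v !hornerE.
clearbody v.
have v0 : v.[x] != 0 by rewrite vE gt_eqF // mulr_gt0 // subr_gt0.
pose f y := p.[y] * (v.[y])^-1 ^+ k * expR (- (v.[y])^-1).
have near_f : \near x, f x = bump p k x.
  near=> y; rewrite /bump ifT /f ?vE //.
  apply/andP; split; near: y; [exact: lt_nbhsr|exact: lt_nbhsl].
apply: (near_eq_is_derive near_f).
rewrite /f.
have dv : is_derive x 1 (fun y => v.[y]^-1) (- v.[x] ^- 2 *: v^`().[x]).
  exact: is_deriveV.
have dk : is_derive x 1 (fun y => v.[y]^-1 ^+ k)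
    ((k%:R * (v.[x]^-1) ^+ k.-1) *: (- v.[x] ^- 2 *: v^`().[x])).
  case: k {near_f f}=> [|k]; first by rewrite mul0r scale0r; exact: is_derive_cst.
  by rewrite -(exprfctE (fun y => v.[y]^-1)); exact: is_deriveX.
have dN : is_derive x 1 (fun y => - v.[y]^-1) (- (- v.[x] ^- 2 *: v^`().[x])).
  exact: is_deriveN.
have de : is_derive x 1 (fun y => expR (- v.[y]^-1))
    (- (- v.[x] ^- 2 *: v^`().[x]) * expR (- v.[x]^-1)).
  rewrite mulrC; exact: (@is_derive1_comp _ expR (fun y => - v.[y]^-1)).
apply: is_derive_eq (is_deriveM (is_deriveM (is_derive_poly p x) dk) de) _.
rewrite /bump x0 x1 /= -!vE mulrfctE /GRing.scale /=.
rewrite !(hornerD, hornerN, hornerM, hornerMn, horner_exp).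
move: (expR _) => e.
case: k {near_f f dk} => [|k] /=.
  by rewrite !expr0 mulr0n; field.
rewrite -mulr_natl !exprVn !exprS.
have vk : v.[x] ^+ k != 0 by rewrite expf_neq0.
by field; rewrite v0 vk.
Unshelve. all: by end_near. Qed.

Definition smooth {R : realType} (f : R -> R) :=
  forall n x, derivable (derive1n n f) x 1.

(** Coinduction principle: a class of derivable functions stable under
    differentiation consists of smooth functions. *)
Lemma smooth_coind {R : realType} (P : (R -> R) -> Prop) :
  (forall f, P f -> (forall x, derivable f x 1) /\ P (derive1 f)) ->
  forall f, P f -> smooth f.
Proof.
move=> HP f Pf n; suff : P (derive1n n f) by move/HP => [].
elim: n => [//|n /HP[_]]; by rewrite derive1nS.
Qed.

Lemma derive1nSr {R : realType} n (f : R -> R) :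
  derive1n n.+1 f = derive1n n (derive1 f).
Proof. by rewrite /derive1n iterSr. Qed.

Lemma smooth_bump {R : realType} (p : {poly R}) k : smooth (bump p k).
Proof.
apply: (@smooth_coind _ (fun f => exists p k, f = bump p k)); last by exists p, k.
move=> _ [q [j ->]]; split=> [x|].
  by have [] := is_derive_bump q j x.
by eexists; eexists; apply/funext => x; rewrite derive1E; have [_ ->] := is_derive_bump q j x.
Qed.

Lemma smooth_derivable {R : realType} (f : R -> R) x : smooth f -> derivable f x 1.
Proof. by move/(_ 0%N). Qed.

Lemma smooth_derive1 {R : realType} (f : R -> R) : smooth f -> smooth (derive1 f).
Proof. by move=> sf n x; rewrite -derive1nSr. Qed.

Lemma smooth_primitive {R : realType} (f : R -> R) :
  (forall x, derivable f x 1) -> smooth (derive1 f) -> smooth f.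
Proof. by move=> df sf [|n] x; [exact: df|rewrite derive1nSr]. Qed.

Lemma smooth_continuous {R : realType} (f : R -> R) : smooth f -> continuous f.
Proof.
by move=> sf x; apply/differentiable_continuous/derivable1_diffP/smooth_derivable.
Qed.

Lemma is_derive_affine {R : realType} (f : R -> R) (c k s x : R) :
  derivable f (k * (x - s)) 1 ->
  is_derive x 1 (fun y => c * f (k * (y - s))) (c * k * derive1 f (k * (x - s))).
Proof.
move=> df.
have h : is_derive x 1 (fun y => k * (y - s)) k.
  rewrite -[fun _ => _]/(k *: (id - cst s)).
  by apply: is_derive_eq; rewrite subr0 /GRing.scale /= mulr1.
have h1 : is_derive (k * (x - s)) 1 f (derive1 f (k * (x - s))).
  by rewrite derive1E; exact: derivableP.
have h2 := @is_derive1_comp _ f (fun y => k * (y - s)) x _ _ h1 h.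
have -> : (fun y => c * f (k * (y - s))) = c *: (f \o (fun y => k * (y - s))) by [].
apply: is_derive_eq; rewrite /GRing.scale /=; ring.
Qed.

Lemma derive1_affine {R : realType} (f : R -> R) (c k s : R) : smooth f ->
  derive1 (fun y => c * f (k * (y - s))) =
  (fun y => c * k * derive1 f (k * (y - s))).
Proof.
move=> sf; apply/funext => x; rewrite derive1E.
by have [_ ->] := is_derive_affine c (@smooth_derivable _ _ (k * (x - s)) sf).
Qed.

Lemma smooth_affine {R : realType} (f : R -> R) (c k s : R) : smooth f ->
  smooth (fun y => c * f (k * (y - s))).
Proof.
move=> sf; apply: (@smooth_coind _ (fun h => exists c f, smooth f /\
  h = fun y => c * f (k * (y - s)))); last by exists c, f.
move=> _ [c' [h [sh ->]]]; split=> [x|].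
  by have [] := is_derive_affine c' (@smooth_derivable _ _ (k * (x - s)) sh).
exists (c' * k), (derive1 h); split; first exact: smooth_derive1.
exact: derive1_affine.
Qed.

Lemma derive1_sub {R : realType} (f g : R -> R) : smooth f -> smooth g ->
  derive1 (fun x => f x - g x) = (fun x => derive1 f x - derive1 g x).
Proof.
move=> sf sg; apply/funext => x.
by rewrite !derive1E -deriveB //; exact: smooth_derivable.
Qed.

Lemma smooth_sub {R : realType} (f g : R -> R) : smooth f -> smooth g ->
  smooth (fun x => f x - g x).
Proof.
move=> sf sg; apply: (@smooth_coind _ (fun h => exists f g, [/\ smooth f, smooth g &
  h = fun x => f x - g x])); last by exists f, g.
move=> _ [f' [g' [sf' sg' ->]]]; split=> [x|].
  by apply: derivableB; exact: smooth_derivable.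
exists (derive1 f'), (derive1 g'); split; [exact: smooth_derive1..|].
exact: derive1_sub.
Qed.

(** The normalized primitive of [bump 1 0]. The bound [M] on the derivative is
    what controls the averages of a function around its Lebesgue points. *)
Lemma exists_smooth_step {R : realType} : exists (S : R -> R) (M : R),
  [/\ smooth S, (forall x, x <= 0 -> S x = 0), (forall x, 1 <= x -> S x = 1),
   (forall x, 0 <= S x <= 1) &
   (forall x, `|derive1 S x| <= M) /\
   (forall x, ~~ (0 < x < 1) -> derive1 S x = 0)].
Proof.
pose b : R -> R := bump 1 0.
have b01 x : ~~ (0 < x < 1) -> b x = 0 by move=> h; rewrite /b /bump (negbTE h).
have b_gt0 x : 0 < x < 1 -> 0 < b x.
  by move=> h; rewrite /b /bump h !hornerE expR_gt0.
have b_ge0 x : 0 <= b x.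
  by have [/b_gt0/ltW//|/b01 ->] := boolP (0 < x < 1).
have sb : smooth b by exact: smooth_bump.
have cb : continuous b by exact: smooth_continuous.
have bE : b = b \_ `[0, 1].
  apply/funext => x; rewrite patchE; case: ifPn => // /negP h; apply: b01.
  by apply/negP => /andP[x0 x1]; apply: h; rewrite inE /= in_itv /= !ltW.
have ib A : measurable A -> lebesgue_measure.-integrable A (EFin \o b).
  move=> mA; apply: (@integrableS _ _ _ _ setT) => //.
  rewrite bE -restrict_EFin -integrable_mkcond //.
  apply: continuous_compact_integrable; first exact: segment_compact.
  exact: continuous_subspaceT.
pose F (x : R) := (\int[lebesgue_measure]_(t in `]-oo, x]) b t)%R.
have FE x : derivable F x 1 /\ derive1 F x = b x.
  by apply: (@continuous_FTC1 _ b -oo%O x (x + 1)); rewrite ?ltrDl ?ltNyr //; [exact: ib|exact: cb].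
have F'E : derive1 F = b by apply/funext => x; have [] := FE x.
have sF : smooth F.
  apply: smooth_primitive => [x|]; first by have [] := FE x.
  by rewrite F'E.
have ndF : {homo F : x y / x <= y}.
  move=> x y xy; apply: (@ger0_derive1_ndecr _ F x y) => //.
  - by move=> z _; exact: smooth_derivable.
  - by move=> z _; rewrite F'E.
  - exact/continuous_subspaceT/smooth_continuous.
have F0 x : x <= 0 -> F x = 0.
  move=> x0; rewrite /F (@eq_Rintegral _ _ _ _ _ (cst 0)) ?Rintegral_cst ?mul0r //.
  move=> y; rewrite inE /= in_itv /= => yx; apply: b01.
  by rewrite ltNge (le_trans yx x0).
have F1 x : 1 <= x -> F x = F 1.
  move=> x1; rewrite /F Rintegral_mkcond [RHS]Rintegral_mkcond.
  congr (fine _); apply: eq_integral => y _; congr EFin.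
  rewrite !patchE !mem_setE !in_itv /=.
  have [y1|y1] := leP y 1; first by rewrite (le_trans y1 x1).
  by case: ifP => // _; apply: b01; rewrite (lt_gtF y1) andbF.
have F10 : 0 < F 1.
  rewrite -(F0 0) //; apply: (@gtr0_derive1_lt_cc _ F 0 1) => //.
  - by move=> z _; exact: smooth_derivable.
  - by move=> z; rewrite in_itv /= => z01; rewrite F'E b_gt0.
  - exact/continuous_subspaceT/smooth_continuous.
  - by rewrite in_itv /= lexx ler01.
  - by rewrite in_itv /= lexx ler01.
have [c _ bc] := EVT_max ler01 (continuous_subspaceT cb : {within `[0, 1], continuous b}).
pose S x := (F 1)^-1 * F (1 * (x - 0)).
have SE x : S x = (F 1)^-1 * F x by rewrite /S mul1r subr0.
have S'E : derive1 S = fun x => (F 1)^-1 * b x.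
  by rewrite derive1_affine // F'E; apply/funext => x; rewrite mulr1 mul1r subr0.
exists S, ((F 1)^-1 * b c); split.
- exact: smooth_affine.
- by move=> x x0; rewrite SE (F0 x) // mulr0.
- by move=> x x1; rewrite SE (F1 x) // mulVf // gt_eqF.
- move=> x; rewrite SE mulrC; apply/andP; split.
    rewrite divr_ge0 ?(ltW F10) //.
    have [x0|x0] := leP x 0; first by rewrite F0.
    by rewrite -(F0 0) // ndF // ltW.
  rewrite ler_pdivrMr // mul1r.
  have [x0|x0] := leP x 1; first by rewrite ndF.
  by rewrite (F1 x) // ltW.
split=> x; last by move=> /b01 h; rewrite S'E h mulr0.
rewrite S'E ger0_norm ?mulr_ge0 ?invr_ge0 ?(ltW F10) // ler_pM2l ?invr_gt0 //.
have [/andP[x0 x1]|/b01 -> //] := boolP (0 < x < 1).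
by apply: bc; rewrite in_itv /= !ltW.
Qed.

(** * Weakly differentiable functions are primitives *)

(** One-sided version of [lebesgue_pt], stated on the intervals [[s, s + h]] that
    carry the derivative of a rescaled smooth step starting at [s]. *)
Definition right_lebesgue_pt {R : realType} (f : R -> R) (s : R) :=
  forall e, 0 < e -> exists2 d, 0 < d & forall h, 0 < h < d ->
    \int[lebesgue_measure]_(y in `[s, s + h]) `|f y - f s| <= e * h.

Section support.
Context {R : realType}.
Local Notation mu := (@lebesgue_measure R).
Implicit Types (A B : set (measurableTypeR R)) (u v : R -> R).

Lemma Rintegral_support A B u : A `<=` B -> (forall x, B x -> ~ A x -> u x = 0) ->
  \int[mu]_(x in B) u x = \int[mu]_(x in A) u x.
Proof.
move=> AB u0; rewrite Rintegral_mkcond [RHS]Rintegral_mkcond; congr (fine _).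
apply: eq_integral => x _; congr EFin; rewrite !patchE.
have [xA|/negP xA] := boolP (x \in A); first by rewrite mem_set //; apply: AB; exact: set_mem.
case: ifPn => // xB; apply: u0; first exact: set_mem.
by move=> Ax; apply: xA; exact: mem_set.
Qed.

Lemma integrable_support A B u : measurable A -> measurable B -> A `<=` B ->
  (forall x, B x -> ~ A x -> u x = 0) ->
  mu.-integrable A (EFin \o u) -> mu.-integrable B (EFin \o u).
Proof.
move=> mA mB AB u0 /(integrable_mkcond _ mA) iu.
apply/(integrable_mkcond _ mB).
suff -> : (EFin \o u) \_ B = (EFin \o u) \_ A by [].
apply/funext => x; rewrite !patchE.
have [xA|/negP xA] := boolP (x \in A); first by rewrite mem_set //; apply: AB; exact: set_mem.
case: ifPn => // xB; rewrite /= u0 //; first exact: set_mem.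
by move=> Ax; apply: xA; exact: mem_set.
Qed.

Lemma integrable_patch A u : measurable A ->
  mu.-integrable A (EFin \o u) -> mu.-integrable setT (EFin \o (u \_ A)).
Proof. by move=> mA /(integrable_mkcond _ mA); rewrite restrict_EFin. Qed.

Lemma integrable_scale A (k : R) u : measurable A ->
  mu.-integrable A (EFin \o u) -> mu.-integrable A (EFin \o (fun y => k * u y)).
Proof.
move=> mA iu; apply: eq_integrable (integrableZl mA k iu) => // x _ /=.
Qed.

Lemma integrable_sub A u v : measurable A ->
  mu.-integrable A (EFin \o u) -> mu.-integrable A (EFin \o v) ->
  mu.-integrable A (EFin \o (fun y => u y - v y)).
Proof.
move=> mA iu iv; apply: eq_integrable (integrableB mA iu iv) => // x _ /=.
Qed.

Lemma integrable_add A u v : measurable A ->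
  mu.-integrable A (EFin \o u) -> mu.-integrable A (EFin \o v) ->
  mu.-integrable A (EFin \o (fun y => u y + v y)).
Proof.
move=> mA iu iv; apply: eq_integrable (integrableD mA iu iv) => // x _ /=.
Qed.

Lemma integrableM_continuous A (p q : R) (f h : R -> R) : measurable A ->
  A `<=` `[p, q] -> mu.-integrable A (EFin \o f) -> continuous h ->
  mu.-integrable A (EFin \o (fun x => f x * h x)).
Proof.
move=> mA Apq fi ch.
have ch' : {within `[p, q], continuous h} by exact: continuous_subspaceT.
apply: (integrableMl _ fi) => //.
  by apply: measurable_funTS; exact: continuous_measurable_fun.
have /compact_bounded[M [_ mrt]] := continuous_compact ch' (@segment_compact _ p q).
exists M; split; rewrite ?num_real // => y My x Ax; apply: (mrt y My).
by exists x => //; exact: Apq.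
Qed.

(** The kernel [h^-1 S' (h^-1 (y - r))] has total mass 1 on [[r, r + h]] and is
    bounded by [M / h], so it recovers [f r] up to [M] times the mean oscillation
    of [f] there. *)
Lemma mollified_value (S : R -> R) (M : R) (f : R -> R) (r h e : R) :
  smooth S -> (forall x, x <= 0 -> S x = 0) -> (forall x, 1 <= x -> S x = 1) ->
  (forall x, `|derive1 S x| <= M) ->
  0 < h -> mu.-integrable `[r, r + h] (EFin \o f) ->
  \int[mu]_(y in `[r, r + h]) `|f y - f r| <= e * h ->
  `|\int[mu]_(y in `[r, r + h]) (f y * (h^-1 * derive1 S (h^-1 * (y - r)))) - f r|
    <= M * e.
Proof.
move=> sS S0 S1 S'M h0 fi fe.
pose s y := 1 * S (h^-1 * (y - r)).
have s'E : derive1 s = fun y => h^-1 * derive1 S (h^-1 * (y - r)).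
  by rewrite derive1_affine // mul1r.
have ss : smooth s by exact: smooth_affine.
have cs' : continuous (derive1 s) by apply/smooth_continuous/smooth_derive1.
have rh : r < r + h by rewrite ltrDl.
have i1 : mu.-integrable `[r, r + h] (EFin \o derive1 s).
  apply: continuous_compact_integrable; first exact: segment_compact.
  exact: continuous_subspaceT.
have int1 : \int[mu]_(y in `[r, r + h]) derive1 s y = 1.
  rewrite /Rintegral (@continuous_FTC2 _ (derive1 s) s) //.
  - by rewrite /s subrr mulr0 (S0 0) // (addrC r h) addrK mulVf ?gt_eqF // S1 //= mulr0 mulr1 subr0.
  - exact: continuous_subspaceT.
  - split; first by move=> x _; exact: smooth_derivable.
      by apply: cvg_at_right_filter; exact: smooth_continuous.
    by apply: cvg_at_left_filter; exact: smooth_continuous.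
have -> : (fun y => f y * (h^-1 * derive1 S (h^-1 * (y - r)))) =
  (fun y => f y * derive1 s y) by rewrite s'E.
have -> : f r = \int[mu]_(y in `[r, r + h]) (f r * derive1 s y).
  by rewrite RintegralZl // int1 mulr1.
have i2 : mu.-integrable `[r, r + h] (EFin \o (fun y => f r * derive1 s y)).
  exact: integrable_scale.
have i3 := integrableM_continuous (measurable_itv _) (@subset_refl _ _) fi cs'.
rewrite -RintegralB //.
have i4 : mu.-integrable `[r, r + h] (EFin \o (fun y => f y * derive1 s y - f r * derive1 s y)).
  exact: integrable_sub.
apply: le_trans (le_normr_Rintegral _ _) _ => //.
have i5 : mu.-integrable `[r, r + h] (EFin \o (fun y => `|f y - f r|)).
  have /integrable_norm // : mu.-integrable `[r, r + h] (EFin \o (fun y => f y - f r)).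
  apply: integrable_sub => //.
  apply: continuous_compact_integrable; [exact: segment_compact|by apply: continuous_subspaceT => ?; exact: cvg_cst].
apply: le_trans (_ : \int[mu]_(y in `[r, r + h]) ((h^-1 * M) * `|f y - f r|) <= _).
  apply: le_Rintegral => //; first exact: (integrable_norm i4).
    exact: integrable_scale.
  move=> y _; rewrite -mulrBl normrM mulrC ler_wpM2r //.
  by rewrite s'E normrM gtr0_norm ?invr_gt0 // ler_wpM2l // invr_ge0 ltW.
rewrite RintegralZl //.
have M0 : 0 <= M by apply: le_trans (S'M 0).
rewrite mulrAC -mulrA ler_pdivrMl // mulrC [leRHS](_ : _ = M * (e * h)).
  exact: ler_wpM2l.
by ring.
Qed.

End support.

Section weak_increment.
Context {R : realType}.
Local Notation mu := (@lebesgue_measure R).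

Lemma locally_integrable_itv (D : set R) (f : R -> R) (p q : R) :
  locally_integrable D f -> `[p, q] `<=` D -> mu.-integrable `[p, q] (EFin \o f).
Proof.
move=> [mf oD lf] pqD; apply/integrableP; split.
  apply/measurable_EFinP; apply: measurable_funS mf => //.
  exact: open_measurable.
exact: lf (pqD) (@segment_compact _ _ _).
Qed.

Lemma normB_unit (x y : R) : 0 <= x <= 1 -> 0 <= y <= 1 -> `|x - y| <= 1.
Proof. by move=> /andP[? ?] /andP[? ?]; rewrite ler_norml; apply/andP; split; lra. Qed.

(** Arithmetic of the limit in [weak_increment]: [X], [Y] approximate the values
    [x], [y] of the function, [G] the integral [I] of its weak derivative. *)
Lemma norm_increment_le (X Y G I x y e : R) : X - Y = - G ->
  `|X - x| <= e / 4 -> `|Y - y| <= e / 4 -> `|G - I| <= e / 2 -> `|y - x - I| <= e.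
Proof.
move=> XYG; rewrite !ler_norml => /andP[? ?] /andP[? ?] /andP[? ?].
by apply/andP; split; lra.
Qed.

(** Fundamental theorem of calculus for weak derivatives. The test function
    [S ((x - s) / h) - S ((x - t) / h)] is a smoothed indicator of [[s, t]]: as
    [h] tends to 0, its derivative evaluates [f] at [s] and [- f] at [t], while
    its product with [g] integrates to the integral of [g] over [[s, t]]. *)
Lemma weak_increment (a : R) (f g : R -> R) (s t : R) :
  is_weak_derivative `]- a, a[ f g -> - a < s -> s < t -> t < a ->
  right_lebesgue_pt f s -> right_lebesgue_pt f t ->
  f t - f s = \int[mu]_(y in `[s, t]) g y.
Proof.
move=> [lf lg fg] as_ st ta fs ft.
have [S [M [sS S0 S1 S01 [S'M S'0]]]] := @exists_smooth_step R.
have M0 : 0 <= M by apply: le_trans (S'M 0).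
pose q := (t + a) / 2; have [tq qa] : t < q /\ q < a by rewrite /q; split; lra.
have JU p r : s <= p -> r <= q -> `[p, r] `<=` `]- a, a[.
  by move=> sp rq x /=; rewrite !in_itv /= => /andP[x1 x2]; lra.
have fi p r : s <= p -> r <= q -> mu.-integrable `[p, r] (EFin \o f).
  by move=> sp rq; apply: locally_integrable_itv lf _; exact: JU.
have gi p r : s <= p -> r <= q -> mu.-integrable `[p, r] (EFin \o g).
  by move=> sp rq; apply: locally_integrable_itv lg _; exact: JU.
apply/eqP; rewrite -subr_eq0 -normr_le0; apply/ler_addgt0Pr => e e0; rewrite add0r.
(* the values of f at s and t are each recovered up to M e1 <= e / 4, the
   integral of g up to e / 2 *)
pose e1 := e / (4 * (M + 1)).
have e10 : 0 < e1 by rewrite divr_gt0 // mulr_gt0 // ltr_wpDl.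
have Me1 : M * e1 <= e / 4.
  rewrite /e1 mulrA ler_pdivrMr ?mulr_gt0 ?ltr_wpDl //.
  have -> : e / 4 * (4 * (M + 1)) = M * e + e by field.
  by rewrite lerDl ltW.
have [d1 d10 fs1] := fs e1 e10.
have [d2 d20 ft1] := ft e1 e10.
pose gJ := g \_ `[s, q].
have igJ : mu.-integrable setT (EFin \o gJ).
  by apply: integrable_patch; [exact: measurable_itv|exact: gi].
have e40 : 0 < e / 2 by rewrite divr_gt0.
have [d3 [d30 gd3]] := integral_normr_continuous igJ e40.
(* 2 h < d3 bounds the measure of the two transition zones *)
pose h := Num.min (Num.min (d1 / 2) (d2 / 2)) (Num.min (d3 / 3) (q - t)).
have h0 : 0 < h by rewrite !lt_min !divr_gt0 //= subr_gt0.
have [hd1 hd2 hd3 hq] : [/\ h < d1, h < d2, 2 * h < d3 & t + h <= q].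
  have : h <= d1 / 2 by rewrite !ge_min lexx.
  have : h <= d2 / 2 by rewrite !ge_min lexx ?orbT.
  have : h <= d3 / 3 by rewrite !ge_min lexx ?orbT.
  have : h <= q - t by rewrite !ge_min lexx ?orbT.
  clear - d10 d20 d30 h0; clearbody h; by split; lra.
pose step r y := 1 * S (h^-1 * (y - r)).
have sst r : smooth (step r) by exact: smooth_affine.
have st'E r : derive1 (step r) = fun y => h^-1 * derive1 S (h^-1 * (y - r)).
  by rewrite /step derive1_affine // mul1r.
have hh x r : h^-1 * (x - r) <= 0 = (x <= r) by rewrite pmulr_rle0 ?invr_gt0 // subr_le0.
have hh1 x r : 1 <= h^-1 * (x - r) = (r + h <= x).
  by rewrite ler_pdivlMl // mulr1 lerBrDl addrC.
have step0 r x : x <= r -> step r x = 0 by rewrite -hh => /S0; rewrite /step => ->; rewrite mulr0.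
have step1 r x : r + h <= x -> step r x = 1.
  by rewrite -hh1 => /S1; rewrite /step => ->; rewrite mulr1.
have step01 r x : 0 <= step r x <= 1 by rewrite /step mul1r.
have step'0 r x : ~ `[r, r + h]%classic x -> derive1 (step r) x = 0.
  move=> /= rh; rewrite st'E S'0 ?mulr0 //; apply/negP => /andP[x0 x1]; apply: rh.
  rewrite in_itv /=; move: x0 x1; rewrite !ltNge hh hh1 -!ltNge => x0 x1.
  by rewrite !ltW.
pose phi x := step s x - step t x.
have sphi : smooth phi by exact: (smooth_sub (sst s) (sst t)).
have phi'E : derive1 phi = fun x => derive1 (step s) x - derive1 (step t) x.
  exact: (derive1_sub (sst s) (sst t)).
have phi0 x : ~ `[s, t + h]%classic x -> phi x = 0.
  rewrite /= in_itv /= => /negP; rewrite negb_and -!ltNge => /orP[xs|xt].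
    by rewrite /phi !step0 ?subrr // ltW // (lt_trans xs).
  by rewrite /phi !step1 ?subrr // ltW // (le_lt_trans _ xt) // lerD2r ltW.
have tphi : test_function `]- a, a[ phi.
  split; first exact: sphi.
  exists `[s, t + h]%classic; split; [exact: segment_compact|exact: JU|exact: phi0].
have {fg}fg := fg _ tphi.
have mU : measurable (`]- a, a[%classic : set (measurableTypeR R)) by exact: measurable_itv.
have fside r : s <= r -> r + h <= q ->
    mu.-integrable `]- a, a[ (EFin \o (fun x => f x * derive1 (step r) x)) /\
    \int[mu]_(x in `]- a, a[) (f x * derive1 (step r) x) =
    \int[mu]_(x in `[r, r + h]) (f x * derive1 (step r) x).
  move=> sr rq.
  have fz x : `]- a, a[%classic x -> ~ `[r, r + h]%classic x -> f x * derive1 (step r) x = 0.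
    by move=> _ /step'0 ->; rewrite mulr0.
  split; last by apply: Rintegral_support => //; exact: JU.
  apply: (@integrable_support _ `[r, r + h]%classic) => //; first exact: JU.
  apply: (integrableM_continuous (measurable_itv _) (@subset_refl _ _)); first exact: fi.
  exact: smooth_continuous (smooth_derive1 (sst r)).
have sh : s + h <= q by apply: le_trans hq; rewrite lerD2r ltW.
have [fsi fsE] := fside s (lexx _) sh.
have [fti ftE] := fside t (ltW st) hq.
have gU x : `]- a, a[%classic x -> ~ `[s, q]%classic x -> g x * phi x = 0.
  move=> _ xq; rewrite phi0 ?mulr0 // => xh; apply: xq.
  by move: xh; rewrite /= !in_itv /= => /andP[-> /le_trans ->].
have igphi : mu.-integrable `[s, q] (EFin \o (fun x => g x * phi x)).
  apply: (integrableM_continuous (measurable_itv _) (@subset_refl _ _)); first exact: gi.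
  exact: smooth_continuous sphi.
have igphiU : mu.-integrable `]- a, a[ (EFin \o (fun x => g x * phi x)).
  by apply: integrable_support igphi => //; exact: JU.
have {fg} fg : \int[mu]_(x in `[s, s + h]) (f x * derive1 (step s) x) -
   \int[mu]_(x in `[t, t + h]) (f x * derive1 (step t) x) =
   - \int[mu]_(x in `[s, q]) (g x * phi x).
  rewrite -fsE -ftE -RintegralB // -(@Rintegral_support _ `[s, q]%classic `]- a, a[%classic _ _ gU); last exact: JU.
  rewrite /Rintegral -fineN -fg; congr fine; apply: eq_integral => x _; congr EFin.
  by rewrite phi'E mulrBr.
have near_value r : s <= r -> r + h <= q ->
    \int[mu]_(y in `[r, r + h]) `|f y - f r| <= e1 * h ->
    `|\int[mu]_(x in `[r, r + h]) (f x * derive1 (step r) x) - f r| <= e / 4.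
  move=> sr rq fr; apply: le_trans Me1; rewrite st'E.
  by apply: mollified_value sS S0 S1 S'M h0 (fi _ _ sr rq) fr.
have fs2 := near_value s (lexx _) sh (fs1 h (introT andP (conj h0 hd1))).
have ft2 := near_value t (ltW st) hq (ft1 h (introT andP (conj h0 hd2))).
pose A : set (measurableTypeR R) := `[s, s + h]%classic `|` `[t, t + h]%classic.
have mA : measurable A by apply: measurableU; exact: measurable_itv.
have Aq : A `<=` `[s, q].
  move=> x [] /=; rewrite !in_itv /= => /andP[x1 x2]; apply/andP; split=> //.
  - exact: le_trans sh.
  - exact: le_trans (ltW st) _.
  - exact: le_trans hq.
have Ad : (mu A < d3%:E)%E.
  apply: (@le_lt_trans _ _ (2 * h)%:E); last by rewrite lte_fin.
have := @measureU2 _ _ _ mu `[s, s + h]%classic `[t, t + h]%classic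
    (measurable_itv _) (measurable_itv _).
  move=> /le_trans; apply.

  rewrite /= !lebesgue_measure_itv /= !lte_fin !ltrDl h0 -!EFinD lee_fin.
  by rewrite le_eqVlt; apply/orP; left; apply/eqP; ring.
have gA := gd3 A mA Ad.
have gst : \int[mu]_(x in `[s, t]) g x = \int[mu]_(x in `[s, q]) (g \_ `[s, t]) x.
  rewrite (@Rintegral_support _ `[s, t]%classic `[s, q]%classic).
  - by apply: eq_Rintegral => x xst; rewrite patchE xst.
  - by move=> x /=; rewrite !in_itv /= => /andP[-> /le_trans ->//]; exact: ltW.
  - by move=> x _ xst; rewrite patchE memNset.
have igst : mu.-integrable `[s, q] (EFin \o (g \_ `[s, t])).
  apply: (@integrableS _ _ _ _ setT) => //.
  by apply: integrable_patch; [exact: measurable_itv|apply: gi => //; exact: ltW].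
have iu := integrable_sub (measurable_itv _) igphi igst.
have gphi2 : `|\int[mu]_(x in `[s, q]) (g x * phi x) - \int[mu]_(x in `[s, t]) g x| <= e / 2.
  rewrite gst -RintegralB //.
  apply: le_trans (le_normr_Rintegral _ _) _ => //.
  apply/ltW; apply: le_lt_trans gA.
  have igA : mu.-integrable setT (EFin \o ((fun x => `|gJ x|) \_ A)).
    apply: integrable_patch => //.
    by apply: (@integrableS _ _ _ _ setT) => //; exact: integrable_norm igJ.
  have -> : \int[mu]_(x in A) `|gJ x| = \int[mu]_(x in `[s, q]) ((fun x => `|gJ x|) \_ A) x.
    rewrite (@Rintegral_support _ A `[s, q]%classic) //.
      by apply: eq_Rintegral => x xst; rewrite patchE xst.
    by move=> x _ xst; rewrite patchE memNset.
  apply: le_Rintegral => //.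
  - exact: integrable_norm iu.
  - by apply: (@integrableS _ _ _ _ setT).
  move=> x xq; rewrite [leRHS]patchE.
  have phi1 : `|phi x| <= 1 by exact: normB_unit.
  have phi2 : `[s, t]%classic x -> `|phi x - 1| <= 1.
    move=> /=; rewrite in_itv /= => /andP[_ xt]; rewrite /phi (step0 t) // subr0.
    by apply: normB_unit => //; rewrite lexx ler01.
  have gJE : gJ x = g x by rewrite /gJ patchE mem_set.
  case: ifPn => [_|/negP xA].
    rewrite gJE patchE; case: ifPn => [/set_mem/phi2 p2|_].
      by rewrite -[X in _ - X]mulr1 -mulrBr normrM ler_piMr.
    by rewrite subr0 normrM ler_piMr.
  suff -> : g x * phi x = (g \_ `[s, t]) x by rewrite subrr normr0.
  have {}xA : ~ A x by move=> Ax; apply: xA; exact: mem_set.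
  rewrite patchE; have [xt|xt] := leP x t.
    rewrite mem_set; last by move: xq; rewrite /= !in_itv /= => /andP[-> _].
    rewrite /phi (step0 t) // step1 ?subr0 ?mulr1 // leNgt; apply/negP => xs.
    by apply: xA; left; move: xq; rewrite /= !in_itv /= => /andP[-> _]; exact: ltW.
  rewrite memNset; last by rewrite /= in_itv /= => /andP[_]; rewrite leNgt xt.
  rewrite phi0 ?mulr0 //= in_itv /= => /andP[_ xth]; apply: xA; right.
  by rewrite /= in_itv /= xth ltW.
exact: norm_increment_le fg fs2 ft2 gphi2.
Qed.

End weak_increment.

Section representation.
Context {R : realType}.
Local Notation mu := (@lebesgue_measure R).

(** The interval [[x, x + h]] is contained in the ball of radius [2 h], which is only
    four times longer. *)
Lemma lebesgue_pt_right (f : R -> R) x :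
  measurable_fun setT f -> lebesgue_pt f x -> right_lebesgue_pt f x.
Proof.
move=> mf lf e e0.
have e40 : (0 < (e / 4)%:E)%E by rewrite lte_fin divr_gt0.
have := lf _ (@open_ereal_lt' _ _ _ e40).
move=> [d /= d0 dP]; exists (d / 2); first by rewrite divr_gt0.
move=> h /andP[h0 hd].
have := dP (2 * h); rewrite /= sub0r normrN gtr0_norm ?mulr_gt0 //.
have -> : 2 * h < d by lra.
move=> /(_ isT isT).
rewrite /davg /iavg lebesgue_measure_ball ?mulr_ge0 ?(ltW h0) //.
set I := (X in (_ * X)%E); set c := 2 * h *+ 2.
have c0 : 0 < c by rewrite /c mulr2n addr_gt0 // mulr_gt0.
rewrite inver gt_eqF // lte_pdivrMl // -EFinM => Ilt.
have IE : (\int[mu]_(y in `[x, (x + h)%R]) (`|f y - f x|%R)%:E <= I)%E.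
  apply: ge0_subset_integral => //.
  - exact: measurable_ball.
  - apply/measurable_EFinP; apply: measurable_funTS; apply: measurableT_comp => //.
    exact: measurable_funB.
  - move=> y /=; rewrite in_itv /= /ball /= => /andP[xy yx].
    by rewrite distrC ger0_norm ?subr_ge0 //; lra.
have J0 : (0 <= \int[mu]_(y in `[x, (x + h)%R]) (`|f y - f x|%R)%:E)%E.
  by apply: integral_ge0 => y _; rewrite lee_fin.
rewrite /Rintegral -lee_fin fineK; last first.
  by rewrite ge0_fin_numE // (le_lt_trans IE) // (lt_trans Ilt) // ltry.
apply: le_trans IE _; apply: le_trans (ltW Ilt) _; rewrite lee_fin /c.
rewrite le_eqVlt; apply/orP; left; apply/eqP; rewrite -mulr_natl; by field.
Qed.

(** Lebesgue differentiation applies to globally integrable functions, hence to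
    the restrictions of [f] to a countable exhaustion of [(-a, a)]. *)
Lemma ae_right_lebesgue_pt (a : R) (f : R -> R) : locally_integrable `]- a, a[ f ->
  {ae mu, forall x, - a < x < a -> right_lebesgue_pt f x}.
Proof.
move=> lf.
pose b n : R := a - n.+1%:R^-1.
pose fn n := f \_ `[- b n, b n].
have bJ n : `[- b n, b n] `<=` `]- a, a[.
  have n0 : 0 < n.+1%:R^-1 :> R by rewrite invr_gt0.
  rewrite /b; move: n0; move: (n.+1%:R^-1) => m m0.
  by move=> x /=; rewrite !in_itv /= => /andP[x1 x2]; apply/andP; split; lra.
have ifn n : mu.-integrable setT (EFin \o fn n).
  by apply: integrable_patch => //; apply: locally_integrable_itv lf _.
have : {ae mu, forall x, forall n, lebesgue_pt (fn n) x}.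
  apply: ae_foralln => n; apply: lebesgue_differentiation.
  by apply: open_integrable_locally => //; exact: openT.
apply: filterS; first exact: (ae_filter_ringOfSetsType mu).
move=> x lx /andP[x1 x2].
have [n [bx1 bx2]] : exists n, - b n < x /\ x < b n.
  have : 0 < Num.min (a - x) (x + a) by rewrite lt_min; apply/andP; split; lra.
  set m := Num.min _ _ => m0.
  have [ma1 ma2] : m <= a - x /\ m <= x + a by rewrite !ge_min !lexx orbT.
  have : exists n, n.+1%:R^-1 < m.
    exists (Num.bound m^-1); rewrite invf_plt ?posrE //.
    apply: lt_le_trans (archi_boundP _) _; first by rewrite invr_ge0 ltW.
    by rewrite ler_nat.
  by move=> [n nm]; exists n; rewrite /b; move: nm; move: (n.+1%:R^-1) => k km; clearbody m; split; lra.
move=> e e0.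
have mfn : measurable_fun setT (fn n) by apply/measurable_EFinP; exact: measurable_int (ifn n).
have [d d0 dP] := lebesgue_pt_right mfn (lx n) e0.
exists (Num.min d (b n - x)); first by rewrite lt_min d0 subr_gt0.
move=> h; rewrite lt_min => /and3P[h0 hd hb].
have := dP h; rewrite h0 hd => /(_ isT); apply: le_trans.
rewrite le_eqVlt; apply/orP; left; apply/eqP; apply: eq_Rintegral => y.
rewrite inE /= in_itv /= => /andP[xy yx].
have fE z : x <= z -> z < b n -> fn n z = f z.
  move=> xz zb; rewrite /fn patchE mem_set //= in_itv /= (ltW zb) andbT.
  by rewrite ltW // (lt_le_trans bx1).
rewrite !fE //; apply: le_lt_trans yx _; lra.
Qed.

Lemma ae_exists_point (p q : R) (P : R -> Prop) : p < q ->
  {ae mu, forall x, P x} -> exists2 x, p < x < q & P x.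
Proof.
move=> pq aeP; apply: contrapT => nP.
have : mu.-negligible `]p, q[.
  apply: negligibleS aeP => x; rewrite /= in_itv /= => xpq Px.
  by apply: nP; exists x.
move/(negligibleP _) => /= => H.
have := H (measurable_itv _); rewrite lebesgue_measure_itv /= lte_fin pq => /eqP.
by rewrite -EFinB eqe subr_eq0 gt_eqF.
Qed.

(** The constant [c] is the value at 0 of the continuous version of [f]. The two
    bounds are all that is needed of the identity [f x = c + int_0^x g]. *)
Lemma weak_representation (a : R) (f g : R -> R) : 0 < a ->
  is_weak_derivative `]- a, a[ f g ->
  exists c, {ae mu, forall x, - a < x < a ->
    (0 < x -> `|f x - c| <= \int[mu]_(y in `]0, x[) `|g y|) /\
    (x < 0 -> `|f x - c| <= \int[mu]_(y in `]x, 0[) `|g y|)}.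
Proof.
move=> a0 fg; have [lf lg _] := fg.
have aef := ae_right_lebesgue_pt lf.
have nq : - a < 0 by rewrite oppr_lt0.
have [s as0 Ps0] := ae_exists_point nq aef.
have /andP[as_ s0] := as0.
have Ps : right_lebesgue_pt f s by apply: Ps0; rewrite as_ (lt_trans s0).
have gi p q : - a < p -> q < a -> mu.-integrable `[p, q] (EFin \o g).
  move=> ap qa; apply: locally_integrable_itv lg _ => x /=; rewrite !in_itv /=.
  by move=> /andP[px xq]; rewrite (lt_le_trans ap px) (le_lt_trans xq qa).
pose G p q := \int[mu]_(y in `[p, q]) g y.
have GD p q r : - a < p -> p <= q -> q <= r -> r < a -> G p r = G p q + G q r.
  move=> ap pq qr ra; apply/eqP; rewrite addrC -subr_eq; apply/eqP.
  rewrite /G Rintegral_itvB ?bnd_simp //; last exact: gi.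
  rewrite Rintegral_itv_obnd_cbnd //.
  by apply: integrableS (gi p r ap ra) => //; apply: subset_itvr; rewrite bnd_simp.
have Gn p q : - a < p -> q < a -> `|G p q| <= \int[mu]_(y in `]p, q[) `|g y|.
  move=> ap qa; apply: le_trans (le_normr_Rintegral _ _) _ => //; first exact: gi.
  have ig : mu.-integrable `[p, q] (EFin \o (fun y => `|g y|)) by exact/integrable_norm/gi.
  have ig2 : mu.-integrable `]p, q] (EFin \o (fun y => `|g y|)).
    by apply: integrableS ig => //; apply: subset_itvr; rewrite bnd_simp.
  rewrite -Rintegral_itv_obnd_cbnd // -Rintegral_itv_bndo_bndc //.
  by apply: integrableS ig2 => //; apply: subset_itvl; rewrite bnd_simp.
have sa : s < a by rewrite (lt_trans s0).
have na0 : - a < 0 by rewrite oppr_lt0.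
exists (f s + G s 0); apply: filterS aef; first exact: (ae_filter_ringOfSetsType mu).
move=> x xf xa.
have {xf} xf := xf xa; move/andP: xa => [ax xa]; split=> x0.
  rewrite (_ : f x - _ = G 0 x); first exact: Gn.
  have := weak_increment fg as_ (lt_trans s0 x0) xa Ps xf.
  rewrite -/(G s x) (GD s 0 x) ?ltW // => H.
  by rewrite opprD addrA H addrAC subrr add0r.
rewrite (_ : f x - _ = - G x 0); first by rewrite normrN; exact: Gn.
have [xs|sx|<-] := ltgtP x s.
- have := weak_increment fg ax xs sa xf Ps.
  rewrite -/(G x s) (GD x s 0) ?ltW // => <-; ring.
- have := weak_increment fg as_ sx xa Ps xf.
  rewrite -/(G s x) (GD s x 0) ?ltW // => <-; ring.
- ring.
Qed.

End representation.

(** * One-sided Hardy inequalities *)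

Section hardy_weights.
Context {R : realType}.
Local Notation mu := (@lebesgue_measure R).
Implicit Types (a t x y C : R) (w D g m u v : R -> R).

(** Meant for [g] integrable near 0; it is the function vanishing at 0 with
    derivative [g]. *)
Definition primitive g x : R := \int[mu]_(y in `]0, x[) g y.

(** Restricting to [g >= 0] loses nothing, since replacing [g] by its absolute value
    increases the left-hand side, and it makes the primitive nondecreasing. *)
Definition hardy_inequality a w C := forall g,
  measurable_fun `]0, a[ g -> (forall x, 0 <= g x) ->
  mu.-integrable `]0, a[ (EFin \o (fun x => g x ^+ 2 * w x)) ->
  \int[mu]_(x in `]0, a[) (primitive g x ^+ 2 * w x) <=
  C * \int[mu]_(x in `]0, a[) (g x ^+ 2 * w x).

(** The last condition bounds [1 / w] on [(0, x)] by [D x / w x], which turns the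
    Cauchy-Schwarz inequality into the pointwise bound [primitive_sqr_le]. It holds
    with [D = 1] for nonincreasing weights. *)
Definition tame a w D :=
  [/\ measurable_fun `]0, a[ w, (forall x, 0 < x < a -> 0 < w x),
      mu.-integrable `]0, a[ (EFin \o w), mu.-integrable `]0, a[ (EFin \o D) &
      forall y x, 0 < y -> y <= x -> x < a -> w x <= D x * w y].

Lemma integrable_le (A : set (measurableTypeR R)) u v : measurable A ->
  measurable_fun A u -> (forall x, A x -> `|u x| <= v x) ->
  mu.-integrable A (EFin \o v) -> mu.-integrable A (EFin \o u).
Proof.
move=> mA mf uv; apply: le_integrable => //; first exact/measurable_EFinP.
move=> x Ax; rewrite /= lee_fin; apply: le_trans (uv x Ax) _.
exact: ler_norm.
Qed.

Lemma subset_oo_itv a x : x <= a -> `]0, x[ `<=` (`]0, a[ : set R).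
Proof. by move=> xa; apply: subset_itvl; rewrite bnd_simp. Qed.

Section tame.
Context a w D g.
Hypothesis tw : tame a w D.
Hypothesis mg : measurable_fun `]0, a[ g.
Hypothesis g0 : forall x, 0 <= g x.
Hypothesis ig : mu.-integrable `]0, a[ (EFin \o (fun x => g x ^+ 2 * w x)).

Let E := \int[mu]_(x in `]0, a[) (g x ^+ 2 * w x).

Lemma tame_gt0 x : 0 < x < a -> 0 < D x.
Proof.
have [_ w0 _ _ wD] := tw => /andP[x0 xa].
have := wD x x x0 (lexx _) xa.
have := w0 x; rewrite x0 xa => /(_ isT) wx.
by rewrite -ler_pdivrMr // divff ?gt_eqF // => /(lt_le_trans ltr01).
Qed.

Lemma tame_inv y x : 0 < y -> y <= x -> x < a -> (w y)^-1 <= D x / w x.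
Proof.
have [_ w0 _ _ wD] := tw => y0 yx xa.
have wy : 0 < w y by rewrite w0 // y0 (le_lt_trans yx).
have wx : 0 < w x by rewrite w0 // xa (lt_le_trans y0).
by rewrite ler_pdivlMr // mulrC ler_pdivrMr // wD.
Qed.

Lemma energy_integrable x : x <= a ->
  mu.-integrable `]0, x[ (EFin \o (fun x => g x ^+ 2 * w x)).
Proof. by move=> xa; apply: integrableS ig => //; exact: subset_oo_itv. Qed.

Lemma energy_ge0 y : 0 < y < a -> 0 <= g y ^+ 2 * w y.
Proof. by have [_ w0 _ _ _] := tw => /w0/ltW wy; rewrite mulr_ge0 // sqr_ge0. Qed.

Lemma energy_le x : x <= a -> \int[mu]_(y in `]0, x[) (g y ^+ 2 * w y) <= E.
Proof.
move=> xa.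
have iE := energy_integrable (lexx a).
have ix := energy_integrable xa.
have mx : measurable (`]0, x[%classic : set (measurableTypeR R)) by exact: measurable_itv.
rewrite (_ : \int[mu]_(y in `]0, x[) _ = \int[mu]_(y in `]0, a[) ((fun y => g y ^+ 2 * w y) \_ `]0, x[) y).
  apply: le_Rintegral => //.
    by apply: (@integrableS _ _ _ _ setT) => //; exact: integrable_patch.
  move=> y /=; rewrite in_itv /= => ya; rewrite patchE; case: ifP => // _.
  exact: energy_ge0.
rewrite (@Rintegral_support _ `]0, x[%classic `]0, a[%classic).
- by apply: eq_Rintegral => y yx; rewrite patchE yx.
- exact: subset_oo_itv.
- by move=> y _ yx; rewrite patchE memNset.
Qed.

(** The square [(l W p - 1)^2] divided by [l W]. *)
Lemma weighted_young (l p W : R) : 0 < l -> 0 < W -> 2 * p <= l * (p ^+ 2 * W) + l^-1 * W^-1.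
Proof.
move=> l0 W0; rewrite -subr_ge0.
have lW : 0 < l * W by rewrite mulr_gt0.
rewrite (_ : _ - _ = (l * W)^-1 * (p * (l * W) - 1) ^+ 2).
  by rewrite mulr_ge0 ?sqr_ge0 // invr_ge0 ltW.
by field; rewrite !gt_eqF.
Qed.

Lemma integrable_cst_itv x k : mu.-integrable `]0, x[ (EFin \o (fun=> k)).
Proof.
have ic : mu.-integrable `[0, x] (EFin \o (fun=> k)).
  apply: continuous_compact_integrable; first exact: segment_compact.
  by apply: continuous_subspaceT => ?; exact: cvg_cst.
apply: integrableS ic => // y /=; rewrite !in_itv /= => /andP[y0 yx].
by rewrite !ltW.
Qed.

Lemma primitive_integrable x : x < a -> mu.-integrable `]0, x[ (EFin \o g).
Proof.
move=> xa.
have h := integrable_add (measurable_itv _) (energy_integrable (ltW xa)) (integrable_cst_itv x (D x / w x)).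
apply: integrable_le h => //.
  by apply: measurable_funS mg => //; apply: subset_oo_itv; exact: ltW.
move=> y /=; rewrite in_itv /= => /andP[y0 yx].
have [_ w0 _ _ _] := tw.
have wy : 0 < w y by rewrite w0 // y0 (lt_trans yx).
rewrite ger0_norm //.
have := weighted_young (g y) ltr01 wy; rewrite mul1r invr1 mul1r => H.
have := tame_inv y0 (ltW yx) xa; have := g0 y; lra.
Qed.

Lemma primitive_ge0 x : 0 <= primitive g x.
Proof. exact: Rintegral_ge0. Qed.

Lemma primitive_le x y : x <= y -> y < a -> primitive g x <= primitive g y.
Proof.
move=> xy ya; rewrite /primitive.
have iy := primitive_integrable ya.
have ix := primitive_integrable (le_lt_trans xy ya).
have mx : measurable (`]0, x[%classic : set (measurableTypeR R)) by exact: measurable_itv.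
rewrite (_ : \int[mu]_(y in `]0, x[) _ = \int[mu]_(y in `]0, y[) (g \_ `]0, x[) y).
  apply: le_Rintegral => //.
    by apply: (@integrableS _ _ _ _ setT) => //; exact: integrable_patch.
  by move=> z _; rewrite patchE; case: ifP.
rewrite (@Rintegral_support _ `]0, x[%classic `]0, y[%classic).
- by apply: eq_Rintegral => z zx; rewrite patchE zx.
- exact: subset_oo_itv.
- by move=> z _ zx; rewrite patchE memNset.
Qed.

(** Optimization in [l]; the best value is [B / P]. *)
Lemma quadratic_discriminant (P e B : R) : 0 <= P -> 0 <= e -> 0 < B ->
  (forall l, 0 < l -> 2 * P <= l * e + l^-1 * B) -> P ^+ 2 <= e * B.
Proof.
move=> P0 e0 B0 H; have [P0'|Pn] := eqVneq P 0; last first.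
  have Pp : 0 < P by rewrite lt0r Pn.
  have := H (B / P) (divr_gt0 B0 Pp).
  rewrite invf_div divfK ?gt_eqF // => h.
  have {h}: P <= B / P * e by lra.
  by rewrite expr2 (mulrC e) -ler_pdivlMr // mulrAC.
by rewrite P0' expr0n /= mulr_ge0 // ltW.
Qed.

(** Cauchy-Schwarz for [g = (g sqrt w) (1 / sqrt w)] on [(0, x)], obtained by
    integrating [weighted_young] and optimizing the parameter. *)
Lemma primitive_sqr_le x : 0 < x < a -> primitive g x ^+ 2 * w x <= a * D x * E.
Proof.
move=> /andP[x0 xa]; have [_ w0 _ _ _] := tw.
have wx : 0 < w x by rewrite w0 ?x0.
have Dx : 0 < D x by rewrite tame_gt0 ?x0.
have E0 : 0 <= E by apply: Rintegral_ge0 => y /=; rewrite in_itv /=; exact: energy_ge0.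
have DW : 0 < D x / w x by rewrite divr_gt0.
have := @quadratic_discriminant (primitive g x) E (x * (D x / w x)) (primitive_ge0 x) E0 (mulr_gt0 x0 DW).
have iE := energy_integrable (ltW xa).
have mx : measurable (`]0, x[%classic : set (measurableTypeR R)) by exact: measurable_itv.
have H l : 0 < l -> 2 * primitive g x <= l * E + l^-1 * (x * (D x / w x)).
  move=> l0; apply: (@le_trans _ _ (l * \int[mu]_(y in `]0, x[) (g y ^+ 2 * w y) + l^-1 * (x * (D x / w x)))); last first.
    by rewrite lerD2r ler_pM2l // energy_le // ltW.
  have -> : l^-1 * (x * (D x / w x)) = \int[mu]_(y in `]0, x[) (l^-1 * (D x / w x)).
    rewrite Rintegral_cst //= lebesgue_measure_itv /= lte_fin x0 /= subr0; ring.
  have -> : l * \int[mu]_(y in `]0, x[) (g y ^+ 2 * w y) =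
      \int[mu]_(y in `]0, x[) (l * (g y ^+ 2 * w y)) by rewrite RintegralZl.
  have -> : 2 * primitive g x = \int[mu]_(y in `]0, x[) (2 * g y).
    by rewrite RintegralZl //; exact: primitive_integrable.
  have il := integrable_scale l mx iE.
  rewrite -RintegralD //; last exact: integrable_cst_itv.
  apply: le_Rintegral => //.
  - exact: integrable_scale mx (primitive_integrable xa).
  - exact: integrable_add mx il (integrable_cst_itv _ _).
  move=> y /=; rewrite in_itv /= => /andP[y0 yx].
  have wy : 0 < w y by rewrite w0 // y0 (lt_trans yx).
  apply: le_trans (weighted_young (g y) l0 wy) _.
  by rewrite lerD2l ler_pM2l ?invr_gt0 // tame_inv // ltW.
move=> /(_ H) h; apply: le_trans (ler_wpM2r (ltW wx) h) _.
rewrite (_ : E * _ * w x = x * (D x * E)); last by field; rewrite gt_eqF.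
by rewrite -mulrA ler_wpM2r ?mulr_ge0 ?(ltW Dx) // ltW.
Qed.

Lemma measurable_if_section (h : R -> R) (b : R * R -> bool) :
  measurable_fun setT h -> measurable_fun setT b ->
  measurable_fun setT (fun z : R * R => (if b z then h z.1 else 0)%:E).
Proof.
move=> mh mb; apply/measurable_EFinP; apply: measurable_fun_ifT => //.
exact: measurableT_comp.
Qed.

(** Measurability of partial integrals in Tonelli's theorem. *)
Lemma measurable_primitive : measurable_fun `]0, a[ (primitive g).
Proof.
pose gI := g \_ `]0, a[.
have mgI : measurable_fun setT gI.
  have mI : measurable (`]0, a[%classic : set (measurableTypeR R)) by exact: measurable_itv.
  exact: (measurable_restrictT g mI).1 mg.
pose f (z : R * R) := (if z.1 < z.2 then gI z.1 else 0)%:E.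
have mf : measurable_fun setT f.
  by apply: measurable_if_section => //; exact: measurable_fun_ltr.
have f0 z : (0 <= f z)%E.
  by rewrite /f lee_fin; case: ifP => // _; rewrite /gI patchE; case: ifP.
have := @measurable_fun_fubini_tonelli_G _ _ _ _ R mu f mf f0.
move=> mG.
have mG' : measurable_fun setT (fine \o fubini_G mu f) by exact: measurableT_comp.
apply: (eq_measurable_fun (fine \o fubini_G mu f)); last exact: measurable_funTS mG'.
move=> x; rewrite inE /= in_itv /= => /andP[x0 xa].
rewrite /fubini_G /f /primitive /Rintegral [in RHS]integral_mkcond; congr fine.
apply: eq_integral => y _ /=; rewrite patchE /gI patchE !mem_setE !in_itv /=.
by case: ltP => // yx; case: ltP => // y0; rewrite ?(lt_trans yx xa).
Qed.

Lemma primitive_sqr_integrable :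
  mu.-integrable `]0, a[ (EFin \o (fun x => primitive g x ^+ 2 * w x)).
Proof.
have [mw w0 _ _ _] := tw.
apply: (@integrable_le _ _ (fun x => (a * E) * D x)).
- exact: measurable_itv.
- by apply: measurable_funM => //; apply: measurable_funX; exact: measurable_primitive.
- move=> x; rewrite /= in_itv /= => xa.
  rewrite ger0_norm; last by apply: mulr_ge0; [exact: sqr_ge0|exact: ltW (w0 _ xa)].
  by rewrite [leRHS]mulrAC primitive_sqr_le.
- have [_ _ _ iD' _] := tw; exact: integrable_scale (measurable_itv _) iD'.
Qed.

End tame.
End hardy_weights.

(** * Multiplying the weight by a nonincreasing factor *)

Section layer_cake.
Context {R : realType}.
Local Notation mu := (@lebesgue_measure R).
Implicit Types (A : set (measurableTypeR R)) (h m : R -> R).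

(** The integral of [h] over the set where [s < m]. Levels [s <= 0] contribute
    nothing, so that the integral over all [s] is the layer cake formula. *)
Definition superlevel_integral A h m (s : R) : \bar R :=
  \int[mu]_(x in A) (if 0 < s < m x then h x else 0)%:E.

Lemma superlevel_integral_ge0 A h m s : (forall x, A x -> 0 <= h x) ->
  (0 <= superlevel_integral A h m s)%E.
Proof. by move=> h0; apply: integral_ge0 => x Ax; rewrite lee_fin; case: ifP => // _; exact: h0. Qed.

Lemma layer_cake A h m : measurable A -> measurable_fun A h ->
  measurable_fun A m -> (forall x, A x -> 0 <= h x) -> (forall x, A x -> 0 <= m x) ->
  measurable_fun setT (superlevel_integral A h m) /\
  (\int[mu]_s superlevel_integral A h m s = \int[mu]_(x in A) (h x * m x)%:E)%E.
Proof.
move=> mA mh mm h0 m0.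
pose hA := h \_ A; pose mmA := m \_ A.
have mhA : measurable_fun setT hA by exact: (measurable_restrictT h mA).1 mh.
have mmmA : measurable_fun setT mmA by exact: (measurable_restrictT m mA).1 mm.
have hA0 x : 0 <= hA x by rewrite /hA patchE; case: ifP => // /set_mem/h0.
have mA0 x : 0 <= mmA x by rewrite /mmA patchE; case: ifP => // /set_mem/m0.
pose f (z : R * R) := (if (0 < z.2) && (z.2 < mmA z.1) then hA z.1 else 0)%:E.
have mf : measurable_fun setT f.
  apply: measurable_if_section => //; apply: measurable_and.
    exact: measurable_fun_ltr.
  by apply: measurable_fun_ltr => //; exact: measurableT_comp.
have f0 z : (0 <= f z)%E by rewrite /f lee_fin; case: ifP.
have SE s : superlevel_integral A h m s = fubini_G mu f s.
  rewrite /superlevel_integral /fubini_G [LHS]integral_mkcond; apply: eq_integral => x _.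
  by rewrite patchE /f /= /hA /mmA !patchE; case: ifP => // _; case: ifP.
split.
  rewrite (_ : superlevel_integral A h m = fubini_G mu f); last exact/funext.
  exact: (@measurable_fun_fubini_tonelli_G _ _ _ _ R mu f mf f0).
under eq_integral do rewrite SE.
have := @fubini_tonelli _ _ _ _ R mu mu f mf f0.
rewrite /fubini_G => <-; rewrite [RHS]integral_mkcond; apply: eq_integral => x _.
rewrite patchE (_ : (if x \in A then (h x * m x)%:E else 0%E) = (hA x * mmA x)%:E); last first.
  by rewrite /hA /mmA !patchE; case: ifP => //; rewrite mul0r.
have [mx0|mxn] := eqVneq (mmA x) 0.
  rewrite mx0 mulr0 integral0_eq // => s _; rewrite /f /= mx0.
  by case: ltP => //= s0; rewrite (lt_gtF s0).
have mx : 0 < mmA x by rewrite lt0r mxn mA0.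
transitivity (\int[mu]_(s in `]0%R, mmA x[) (hA x)%:E)%E.
  rewrite [RHS]integral_mkcond; apply: eq_integral => s _.
  by rewrite patchE /f /= mem_setE in_itv /=; case: ifP.
rewrite integral_cst //= lebesgue_measure_itv /= lte_fin mx.
by rewrite -EFinD subr0 EFinM.
Qed.

End layer_cake.

Section hardy_gain.
Context {R : realType}.
Local Notation mu := (@lebesgue_measure R).
Variables (a : R) (w D m D' : R -> R) (A t1 t2 : R).
Hypothesis tw : tame a w D.
Hypothesis mm : measurable_fun `]0, a[ m.
Hypothesis m_gt0 : forall x, 0 < x < a -> 0 < m x.
Hypothesis m_ni : forall y x, 0 < y -> y <= x -> x < a -> m x <= m y.
Hypothesis twm : tame a (fun x => w x * m x) D'.
Hypothesis A0 : 0 <= A.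
Hypothesis hw : hardy_inequality a w A.
Hypotheses (t10 : 0 < t1) (t12 : t1 < t2) (t2a : t2 < a).
Variable g : R -> R.
Hypothesis mg : measurable_fun `]0, a[ g.
Hypothesis g0 : forall x, 0 <= g x.
Hypothesis ig : mu.-integrable `]0, a[ (EFin \o (fun x => g x ^+ 2 * (w x * m x))).

Let I : set (measurableTypeR R) := `]0, a[%classic.
Let mI : measurable I. Proof. exact: measurable_itv. Qed.
Let cut s x := if 0 < s < m x then g x else 0.
Let F := primitive g.
Let tail x := if t2 < x then F t1 ^+ 2 * w x else 0.

Let FW x := F x ^+ 2 * w x.
Let GW x := g x ^+ 2 * w x.

Let IP x : I x -> 0 < x < a. Proof. by rewrite /I /= in_itv. Qed.

Let w_gt0 x : I x -> 0 < w x.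
Proof. by move=> /IP; have [_ w0 _ _ _] := tw; exact: w0. Qed.

Let mw : measurable_fun I w. Proof. by have [] := tw. Qed.

Let measurable_cut s : measurable_fun I (cut s).
Proof.
apply: measurable_fun_if => //.
- by apply: measurable_and => //; exact: measurable_fun_ltr.
- by apply: measurable_funS mg => //; exact: subIsetl.
Qed.

Let cut_ge0 s x : 0 <= cut s x. Proof. by rewrite /cut; case: ifP. Qed.

Let cut_integrable s : 0 < s ->
  mu.-integrable I (EFin \o (fun x => cut s x ^+ 2 * w x)).
Proof.
move=> s0; apply: (integrable_le (v := fun x => s^-1 * (g x ^+ 2 * (w x * m x)))) => //.
- by apply: measurable_funM => //; exact: measurable_funX.
- move=> x Ix; have wx := w_gt0 Ix; have mx := m_gt0 (IP Ix).
  rewrite ger0_norm; last by apply: mulr_ge0; [exact: sqr_ge0|exact: ltW].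
  rewrite /cut s0 /=; case: ifP => [smx|_].
    rewrite (_ : s^-1 * _ = g x ^+ 2 * w x * (m x / s)); last first.
      by field; rewrite gt_eqF.
    rewrite ler_peMr ?ler_pdivlMr // ?mul1r; last exact: ltW.
    by apply: mulr_ge0; [exact: sqr_ge0|exact: ltW].
  rewrite expr0n /= mul0r; apply: mulr_ge0; first by rewrite invr_ge0 ltW.
  by apply: mulr_ge0; [exact: sqr_ge0|rewrite mulr_ge0 // ltW].
- exact: integrable_scale.
Qed.

Let primitive_cut s x : 0 < s -> I x -> s < m x -> primitive (cut s) x = F x.
Proof.
move=> s0 /IP/andP[x0 xa] smx; apply: eq_Rintegral => y.
rewrite inE /= in_itv /= => /andP[y0 yx].
by rewrite /cut s0 /= (lt_le_trans smx) // m_ni // ltW.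
Qed.

(** On the superlevel set the truncated primitive agrees with [F]. At the levels
    between [m t2] and [m t1], the set contains [t1] but no point beyond [t2], so
    to the right of [t2] the truncated primitive is still at least [F t1]. *)
Let cut_le s x : 0 < s -> I x ->
  (if 0 < s < m x then F x ^+ 2 * w x else 0) +
  (if m t2 <= s < m t1 then tail x else 0) <= primitive (cut s) x ^+ 2 * w x.
Proof.
move=> s0 Ix; have wx := w_gt0 Ix; have /andP[x0 xa] := IP Ix.
have P0 : 0 <= primitive (cut s) x ^+ 2 * w x.
  by apply: mulr_ge0; [exact: sqr_ge0|exact: ltW].
rewrite s0 /=; case: ifP => [smx|sNmx].
  rewrite primitive_cut // -[leRHS]addr0 lerD2l.
  case: ifP => // /andP[mt2s _]; rewrite /tail; case: ifP => // t2x.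
  have := m_ni (lt_trans t10 t12) (ltW t2x) xa.
  by move=> /(lt_le_trans smx); rewrite ltNge mt2s.
rewrite add0r; case: ifP => // /andP[mt2s smt1]; rewrite /tail; case: ifP => // t2x.
rewrite ler_wpM2r ?(ltW wx) // ler_pXn2r ?nnegrE ?primitive_ge0 //.
have It1 : I t1 by rewrite /I /= in_itv /= t10 (lt_trans t12).
rewrite -(primitive_cut s0 It1 smt1).
apply: (primitive_le tw) => //.
- exact: measurable_cut.
- exact: cut_integrable.
- exact: ltW (lt_trans t12 t2x).
Qed.

Let mF : measurable_fun I F.
Proof. exact: measurable_primitive. Qed.

Let tail_ge0 x : I x -> 0 <= tail x.
Proof.
move=> Ix; rewrite /tail; case: ifP => // _.
by apply: mulr_ge0; [exact: sqr_ge0|exact: ltW (w_gt0 Ix)].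
Qed.

Let measurable_tail : measurable_fun I tail.
Proof.
apply: measurable_fun_if => //; first exact: measurable_fun_ltr.
by apply: measurable_funM => //; apply: measurable_funS mw => //; exact: subIsetl.
Qed.

Let mFW : measurable_fun I FW.
Proof. by apply: measurable_funM => //; exact: measurable_funX. Qed.

Let mGW : measurable_fun I GW.
Proof. by apply: measurable_funM => //; exact: measurable_funX. Qed.

Let FW_ge0 x : I x -> 0 <= FW x.
Proof. by move=> Ix; apply: mulr_ge0; [exact: sqr_ge0|exact: ltW (w_gt0 Ix)]. Qed.

Let GW_ge0 x : I x -> 0 <= GW x.
Proof. by move=> Ix; apply: mulr_ge0; [exact: sqr_ge0|exact: ltW (w_gt0 Ix)]. Qed.

(** At level [s > 0] this is the Hardy inequality with weight [w] for [cut s]. That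
    truncation has finite energy because [w <= s^-1 w m] where [s < m]; at level 0 this
    could fail, but a single level does not matter. *)
Let superlevel_le s :
  (superlevel_integral I FW m s +
   (if (m t2 <= s < m t1)%R then \int[mu]_(x in I) (tail x)%:E else 0) <=
   A%:E * superlevel_integral I GW m s)%E.
Proof.
have [s0|s0] := leP s 0.
  have mt2 : 0 < m t2 by rewrite m_gt0 // t2a (lt_trans t10).
  rewrite (lt_geF (le_lt_trans s0 mt2)) /= adde0 /superlevel_integral.
  rewrite !integral0_eq ?mule0 // => x _; by rewrite ltNge s0.
have -> : superlevel_integral I GW m s =
    (\int[mu]_(x in I) (cut s x ^+ 2 * w x))%:E.
  rewrite /Rintegral fineK; last exact: integrable_fin_num (cut_integrable s0).
  apply: eq_integral => x _; rewrite /cut /GW; case: ifP => //.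
  by rewrite expr0n mul0r.
rewrite -EFinM.
apply: le_trans (_ : (\int[mu]_(x in I) (primitive (cut s) x ^+ 2 * w x)%R)%:E <= _)%E; last first.
  by rewrite lee_fin; exact: (hw (measurable_cut s) (cut_ge0 s) (cut_integrable s0)).
rewrite /Rintegral fineK; last first.
  apply: integrable_fin_num => //.
  exact: (primitive_sqr_integrable tw (measurable_cut s) (cut_ge0 s) (cut_integrable s0)).
have -> : (if m t2 <= s < m t1 then (\int[mu]_(x in I) (tail x)%:E)%E else 0%E) =
    (\int[mu]_(x in I) (if m t2 <= s < m t1 then tail x else 0)%:E)%E.
  by case: ifP => // _; rewrite integral0_eq.
have m1 : measurable_fun I (fun x => (if 0 < s < m x then FW x else 0)%:E).
  apply/measurable_EFinP; apply: measurable_fun_if => //.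
  - by apply: measurable_and => //; exact: measurable_fun_ltr.
  - by apply: measurable_funS mFW => //; exact: subIsetl.
have m2 : measurable_fun I (fun x => (if m t2 <= s < m t1 then tail x else 0)%:E).
  by apply/measurable_EFinP; case: (m t2 <= s < m t1).
rewrite /superlevel_integral -ge0_integralD //.
- apply: ge0_le_integral => //.
  + move=> x Ix; rewrite -EFinD lee_fin addr_ge0 //.
      by case: ifP => // _; exact: FW_ge0.
    by case: ifP => // _; exact: tail_ge0.
  + exact: emeasurable_funD.
  + apply/measurable_EFinP; apply: measurable_funM => //; apply: measurable_funX.
    by apply: measurable_primitive; [exact: measurable_cut|exact: cut_ge0].
  + by move=> x Ix; rewrite -EFinD lee_fin; exact: cut_le.
- by move=> x Ix; rewrite lee_fin; case: ifP => // _; exact: FW_ge0.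
- by move=> x Ix; rewrite lee_fin; case: ifP => // _; exact: tail_ge0.
Qed.

(** Integral of [superlevel_le] over the levels; the surplus is present at the
    levels between [m t2] and [m t1]. *)
Lemma hardy_gain :
  \int[mu]_(x in `]0, a[) (F x ^+ 2 * (w x * m x)) +
  (F t1 ^+ 2 * \int[mu]_(x in `]0, a[) (if t2 < x then w x else 0)) * (m t1 - m t2) <=
  A * \int[mu]_(x in `]0, a[) (g x ^+ 2 * (w x * m x)).
Proof.
have m0 x : I x -> 0 <= m x by move=> /IP/m_gt0/ltW.
have [mS1 eS1] := layer_cake mI mFW mm FW_ge0 m0.
have [mS2 eS2] := layer_cake mI mGW mm GW_ge0 m0.
have It1 : 0 < t1 < a by rewrite t10 (lt_trans t12).
have It2 : 0 < t2 < a by rewrite t2a (lt_trans t10).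
have m21 : m t2 <= m t1 by apply: m_ni => //; exact: ltW.
pose W := \int[mu]_(x in `]0, a[) (if t2 < x then w x else 0).
have iW : mu.-integrable I (EFin \o (fun x => if t2 < x then w x else 0)).
  apply: (integrable_le (v := w)) => //.
  - apply: measurable_fun_if => //; first exact: measurable_fun_ltr.
    by apply: measurable_funS mw => //; exact: subIsetl.
  - by move=> x Ix; case: ifP => _; rewrite ?normr0 ?ger0_norm // ltW // w_gt0.
  - by have [] := tw.
have GE : (\int[mu]_(x in I) (tail x)%:E = (F t1 ^+ 2 * W)%:E)%E.
  rewrite /W -RintegralZl // /Rintegral fineK; last first.
    by apply: integrable_fin_num => //; exact: integrable_scale mI iW.
  by apply: eq_integral => x _; rewrite /tail; case: ifP => //; rewrite mulr0.
pose J s : \bar R := if m t2 <= s < m t1 then (F t1 ^+ 2 * W)%:E else 0%E.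
have W0 : 0 <= W by apply: Rintegral_ge0 => x Ix; case: ifP => // _; exact/ltW/w_gt0.
have FW0 : 0 <= F t1 ^+ 2 * W by rewrite mulr_ge0 ?sqr_ge0.
have JE : J = (cst (F t1 ^+ 2 * W)%:E) \_ `[m t2, m t1[.
  by apply/funext => s; rewrite patchE mem_setE in_itv.
have mJ : measurable_fun setT J.
  have mI2 : measurable (`[m t2, m t1[%classic : set (measurableTypeR R)) by exact: measurable_itv.
  rewrite JE; exact: (measurable_restrictT (cst (F t1 ^+ 2 * W)%:E) mI2).1 (measurable_cst _).
have J0 s : (0 <= J s)%E by rewrite /J; case: ifP => // _; rewrite lee_fin.
have iJ : (\int[mu]_s J s = ((F t1 ^+ 2 * W) * (m t1 - m t2))%:E)%E.
  rewrite JE -integral_mkcond integral_cst //= lebesgue_measure_itv /= lte_fin.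
  case: ltP => [m12|m12]; first by rewrite -EFinB -EFinM.
  by rewrite (_ : m t1 = m t2) ?subrr ?mulr0 ?mule0 //; apply/eqP; rewrite eq_le m12.
have S10 s : (0 <= superlevel_integral I FW m s)%E by apply: superlevel_integral_ge0.
have S20 s : (0 <= superlevel_integral I GW m s)%E by apply: superlevel_integral_ge0.
have : (\int[mu]_s (superlevel_integral I FW m s + J s) <=
        \int[mu]_s (A%:E * superlevel_integral I GW m s))%E.
  apply: ge0_le_integral => //.
  - by move=> s _; rewrite adde_ge0.
  - by apply: emeasurable_funD; [exact: mS1|exact: mJ].
  - by apply: emeasurable_funM; [exact: measurable_cst|exact: mS2].
  - by move=> s _; rewrite /J -GE; exact: superlevel_le.
rewrite ge0_integralD // iJ eS1 ge0_integralZl // ?lee_fin // eS2.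
have FE : (\int[mu]_(x in I) (FW x * m x)%:E)%E =
    (\int[mu]_(x in `]0, a[) (F x ^+ 2 * (w x * m x)))%:E.
  rewrite /Rintegral fineK; last first.
    by apply: integrable_fin_num => //; exact: (primitive_sqr_integrable twm mg g0 ig).
  by apply: eq_integral => x _; rewrite /FW mulrA.
have GE' : (\int[mu]_(x in I) (GW x * m x)%:E)%E =
    (\int[mu]_(x in `]0, a[) (g x ^+ 2 * (w x * m x)))%:E.
  rewrite /Rintegral fineK; last exact: integrable_fin_num.
  by apply: eq_integral => x _; rewrite /GW mulrA.
by rewrite FE GE' -EFinD -EFinM lee_fin.
Qed.
End hardy_gain.

(** * From the surplus to a smaller constant *)

Section hardy_perturb.
Context {R : realType}.
Local Notation mu := (@lebesgue_measure R).
Implicit Types (a b t x y : R) (w D g : R -> R).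

Definition tail_mass a b w : R := \int[mu]_(x in `]0, a[) (if b < x then w x else 0).

Lemma integrable_if_lt a b w : mu.-integrable `]0, a[ (EFin \o w) ->
  mu.-integrable `]0, a[ (EFin \o (fun x => if b < x then w x else 0)).
Proof.
move=> iw.
have mw : measurable_fun `]0, a[ w by apply/measurable_EFinP; exact: measurable_int iw.
apply: (integrable_le (v := fun x => `|w x|)) (integrable_norm iw) => //.
- apply: measurable_fun_if => //; first exact: measurable_fun_ltr.
  by apply: measurable_funS mw => //; exact: subIsetl.
- by move=> x _; case: ifP => _; rewrite ?normr0.
Qed.

(** Tameness bounds [w] from below on [(b, x0)] by [w x0 / D x0]. *)
Lemma tail_mass_gt0 a b w D : tame a w D -> 0 < b -> b < a -> 0 < tail_mass a b w.
Proof.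
move=> tw b0 ba; have [mw w0 iw _ _] := tw.
pose x0 := (b + a) / 2.
have [bx0 x0a] : b < x0 /\ x0 < a by rewrite /x0; split; lra.
have x00 : 0 < x0 < a by rewrite x0a (lt_trans b0).
have wD : 0 < w x0 / D x0 by rewrite divr_gt0 ?w0 // (tame_gt0 tw).
apply: (@lt_le_trans _ _ (\int[mu]_(x in `]b, x0[) (w x0 / D x0))).
  rewrite Rintegral_cst //= lebesgue_measure_itv /= lte_fin bx0 /=.
  by rewrite mulr_gt0 // subr_gt0.
have bI : `]b, x0[ `<=` (`]0, a[ : set R).
  move=> x /=; rewrite !in_itv /= => /andP[bx xx0].
  by rewrite (lt_trans b0) // (lt_trans xx0).
rewrite (_ : \int[mu]_(x in `]b, x0[) _ = \int[mu]_(x in `]0, a[) (cst (w x0 / D x0) \_ `]b, x0[) x); last first.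
  rewrite [RHS](@Rintegral_support _ `]b, x0[%classic).
  - by apply: eq_Rintegral => x xb; rewrite patchE xb.
  - exact: bI.
  - by move=> x _ xb; rewrite patchE memNset.
apply: le_Rintegral => //.
- apply: (@integrableS _ _ _ _ setT) => //; apply: integrable_patch => //.
  apply: integrableS (integrable_cst_itv a (w x0 / D x0)) => //.
- exact: integrable_if_lt.
move=> x; rewrite /= in_itv /= => /andP[xp xa]; rewrite patchE mem_setE in_itv /=.
case: ifP => [/andP[bx xx0]|_].
  rewrite bx /cst ler_pdivrMr ?(tame_gt0 tw) // mulrC.
  by have [_ _ _ _ h] := tw; apply: h => //; exact: ltW.
by case: ifP => // _; rewrite ltW // w0 // xp.
Qed.

(** Absolute continuity of the integral. *)
Lemma tail_mass_small a b D e : 0 < b -> b < a -> 0 < e -> (forall x, 0 < x < a -> 0 <= D x) ->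
  mu.-integrable `]0, a[ (EFin \o D) ->
  exists2 c, b <= c < a & tail_mass a c D <= e.
Proof.
move=> b0 ba e0 D0 iD.
have iDT := integrable_patch (measurable_itv _) iD.
have [d [d0 Dd]] := integral_normr_continuous iDT e0.
pose c := Num.max b (a - d / 2).
have ca : c < a by rewrite /c gt_max ba /= gtrBl divr_gt0.
have bc : b <= c by rewrite /c le_max lexx.
have c0 : 0 < c by apply: lt_le_trans bc.
exists c; first by rewrite bc.
have mc : measurable (`]c, a[%classic : set (measurableTypeR R)) by exact: measurable_itv.
have muc : (mu `]c, a[%classic < d%:E)%E.
  rewrite lebesgue_measure_itv /= lte_fin ca -EFinB lte_fin.
  have : a - d / 2 <= c by rewrite le_max lexx orbT.
  move: c {ca bc c0 mc} => c; lra.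
have := Dd _ mc muc; move/ltW; apply: le_trans.
have cI : `]c, a[ `<=` (`]0, a[ : set R).
  by move=> x /=; rewrite !in_itv /= => /andP[bx ->]; rewrite (lt_trans c0).
rewrite /tail_mass (@Rintegral_support _ `]c, a[%classic) //; last first.
  by move=> x /=; rewrite !in_itv /= => /andP[_ xa]; rewrite xa andbT => /negP/negbTE ->.
rewrite le_eqVlt; apply/orP; left; apply/eqP; apply: eq_Rintegral => x.
rewrite inE => xc; have xI := cI _ xc; rewrite patchE mem_set //.
move: xc xI; rewrite /= !in_itv /= => /andP[-> _] xI.
by rewrite ger0_norm // D0.
Qed.

Lemma inv_weight_integrable a w D x : tame a w D -> x < a -> 0 < x ->
  mu.-integrable `]0, x[ (EFin \o (fun y => (w y)^-1)).
Proof.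
move=> tw xa x0; have [mw w0 _ _ _] := tw.
have yI y : `]0, x[%classic y -> 0 < y < a.
  by rewrite /= in_itv /= => /andP[-> /lt_trans ->].
apply: (integrable_le (v := fun=> D x / w x)) (integrable_cst_itv x _) => //.
- have mwx : measurable_fun `]0, x[ w.
    by apply: measurable_funS mw => //; apply: subset_oo_itv; exact: ltW.
  have mV := measurableT_comp (measurable_powR (-1)) mwx.
  apply: eq_measurable_fun mV => y; rewrite inE => /yI/w0/ltW wy.
  by rewrite /= powR_inv1.
- move=> y yx; have wy := w0 y (yI y yx).
  rewrite ger0_norm ?invr_ge0 ?(ltW wy) //; move: yx; rewrite /= in_itv /= => /andP[y0 yx].
  by apply: (tame_inv tw) => //; exact: ltW.
Qed.

(** From [2 <= l w + l^-1 w^-1] integrated over [(0, t)], with [l] so small that the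
    first term contributes at most [t]. *)
Lemma resistance_gt0 a w D t : 0 < t -> t < a -> tame a w D ->
  0 < primitive (fun x => (w x)^-1) t.
Proof.
move=> t0 ta tw; have [_ w0 iw _ _] := tw.
have mt : measurable (`]0, t[%classic : set (measurableTypeR R)) by exact: measurable_itv.
have iV := inv_weight_integrable tw ta t0.
have itI : `]0, t[ `<=` `]0, a[ by apply: subset_oo_itv; exact: ltW.
have iwt : mu.-integrable `]0, t[ (EFin \o w) by apply: integrableS iw.
set Z := \int[mu]_(x in `]0, t[) w x.
have Z0 : 0 <= Z.
  by apply: Rintegral_ge0 => y yt; apply/ltW/w0; have := itI y yt; rewrite /= in_itv.
have l0 : 0 < t / (Z + 1) by rewrite divr_gt0 // ltr_wpDl.
set l := t / (Z + 1) in l0 *.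
have H : 2 * t <= l * Z + l^-1 * primitive (fun x => (w x)^-1) t.
  rewrite /primitive /Z -RintegralZl // -RintegralZl //.
  have -> : 2 * t = \int[mu]_(y in `]0, t[) 2.
    by rewrite Rintegral_cst //= lebesgue_measure_itv /= lte_fin t0 /= subr0.
  have i1 := integrable_scale l mt iwt.
  have i2 := integrable_scale l^-1 mt iV.
  rewrite -RintegralD //; apply: le_Rintegral => //.
  - exact: integrable_cst_itv.
  - exact: integrable_add mt i1 i2.
  move=> y yt; have wy : 0 < w y by apply: w0; have := itI y yt; rewrite /= in_itv.
  by have := weighted_young 1 l0 wy; rewrite expr1n mulr1 mul1r.
have lZ : l * Z <= t.
  by rewrite /l mulrAC ler_pdivrMr ?ltr_wpDl // ler_pM2l // lerDl.
have : 0 < l^-1 * primitive (fun x => (w x)^-1) t by move: H lZ t0; clear; lra.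
by rewrite pmulr_rgt0 // invr_gt0.
Qed.

Section perturb.
Variables (a : R) (w D g : R -> R) (A t1 b s : R).
Hypothesis tw : tame a w D.
Hypothesis hw : hardy_inequality a w A.
Hypotheses (t10 : 0 < t1) (t1b : t1 <= b) (ba : b < a) (s0 : 0 <= s).
Hypothesis mg : measurable_fun `]0, a[ g.
Hypothesis g0 : forall x, 0 <= g x.
Hypothesis ig : mu.-integrable `]0, a[ (EFin \o (fun x => g x ^+ 2 * w x)).

Let I : set (measurableTypeR R) := `]0, a[%classic.
Let mI : measurable I. Proof. exact: measurable_itv. Qed.
Let p x := if 0 < x < t1 then (w x)^-1 else 0.
Let F := primitive g.
Let L := primitive (fun x => (w x)^-1) t1.

Let t1a : t1 < a. Proof. exact: le_lt_trans ba. Qed.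

Let IP x : I x -> 0 < x < a. Proof. by rewrite /I /= in_itv. Qed.

Let w_gt0 x : I x -> 0 < w x.
Proof. by move=> /IP; have [_ w0 _ _ _] := tw; exact: w0. Qed.

Let It1 x : 0 < x < t1 -> I x.
Proof. by rewrite /I /= in_itv /= => /andP[-> /lt_trans ->]. Qed.

Let p_ge0 x : 0 <= p x.
Proof. by rewrite /p; case: ifP => // /It1/w_gt0 wx; rewrite invr_ge0 ltW. Qed.

Let integrable_p : mu.-integrable I (EFin \o p).
Proof.
have t1I : `]0, t1[ `<=` I by apply: subset_oo_itv; exact: ltW.
apply: (integrable_support (A := `]0, t1[%classic)) => //.
  by move=> x _; rewrite /= in_itv /p /= => /negP/negbTE ->.
apply: eq_integrable (inv_weight_integrable tw t1a t10) => // x.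
by rewrite inE /= in_itv /p /= => ->.
Qed.

Let measurable_p : measurable_fun I p.
Proof. by apply/measurable_EFinP; exact: measurable_int integrable_p. Qed.

Let int_p : \int[mu]_(x in I) p x = L.
Proof.
rewrite (@Rintegral_support _ `]0, t1[%classic).
- by apply: eq_Rintegral => x; rewrite inE /= in_itv /p /= => ->.
- by apply: subset_oo_itv; exact: ltW.
- by move=> x _; rewrite /= in_itv /p /= => /negP/negbTE ->.
Qed.

Let primitive_p x : t1 <= x -> primitive p x = L.
Proof.
move=> t1x; rewrite /primitive (@Rintegral_support _ `]0, t1[%classic).
- by apply: eq_Rintegral => y; rewrite inE /= in_itv /p /= => ->.
- exact: subset_oo_itv.
- by move=> y _; rewrite /= in_itv /p /= => /negP/negbTE ->.
Qed.

(** Hardy for [g + s p], where [p = 1 / w] on [(0, t1)] and 0 beyond. This choice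
    makes the cross term in the energy equal to [2 s F t1], while the primitive
    of [p] is the positive constant [L] from [t1] on. *)
Lemma hardy_perturb :
  \int[mu]_(x in `]0, a[) (F x ^+ 2 * w x) + 2 * s * F b * L * tail_mass a b w <=
  A * (\int[mu]_(x in `]0, a[) (g x ^+ 2 * w x) + 2 * s * F t1 + s ^+ 2 * L).
Proof.
pose h x := g x + s * p x.
have h0 x : 0 <= h x by rewrite addr_ge0 // mulr_ge0.
have mh : measurable_fun I h.
  by apply: measurable_funD => //; apply: measurable_funM.
pose gt x := if 0 < x < t1 then g x else 0.
have hE x : I x -> h x ^+ 2 * w x = (g x ^+ 2 * w x + (2 * s) * gt x) + s ^+ 2 * p x.
  move=> Ix; have wx := w_gt0 Ix; rewrite /h /p /gt; case: ifP => _; last by ring.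
  by field; rewrite gt_eqF.
have igt1 : mu.-integrable `]0, t1[ (EFin \o g) by exact: (primitive_integrable tw).
have it1I : `]0, t1[ `<=` I by apply: subset_oo_itv; exact: ltW.
have igt : mu.-integrable I (EFin \o gt).
  apply: (integrable_support (A := `]0, t1[%classic)) => //.
    by move=> x _; rewrite /= in_itv /gt /= => /negP/negbTE ->.
  apply: eq_integrable igt1 => // x.
  by rewrite inE /= in_itv /gt /= => ->.
have int_gt : \int[mu]_(x in I) gt x = F t1.
  rewrite (@Rintegral_support _ `]0, t1[%classic) //.
  - by apply: eq_Rintegral => x; rewrite inE /= in_itv /gt /= => ->.
  - by move=> x _; rewrite /= in_itv /gt /= => /negP/negbTE ->.
have i1 := integrable_scale (2 * s) mI igt.
have i2 := integrable_scale (s ^+ 2) mI integrable_p.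
have i3 := integrable_add mI ig i1.
have ih : mu.-integrable I (EFin \o (fun x => h x ^+ 2 * w x)).
  apply: eq_integrable (integrable_add mI i3 i2) => // x.
  by rewrite inE => Ix /=; rewrite hE.
have Eh : \int[mu]_(x in I) (h x ^+ 2 * w x) =
    \int[mu]_(x in `]0, a[) (g x ^+ 2 * w x) + 2 * s * F t1 + s ^+ 2 * L.
  rewrite -int_gt -int_p -RintegralZl // -RintegralZl // -RintegralD // -RintegralD //.
  by apply: eq_Rintegral => x; rewrite inE; exact: hE.
rewrite -Eh; apply: le_trans (hw mh h0 ih).
have iF := primitive_sqr_integrable tw mg g0 ig.
have iw : mu.-integrable I (EFin \o w) by have [] := tw.
have itw := integrable_if_lt b iw.
rewrite /tail_mass -RintegralZl //.
have itw' := integrable_scale (2 * s * F b * L) mI itw.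
rewrite -RintegralD //; apply: le_Rintegral => //.
- exact: integrable_add mI iF itw'.
- exact: (primitive_sqr_integrable tw mh h0 ih).
move=> x Ix; have /andP[x0 xa] := IP Ix; have wx := w_gt0 Ix.
have Pp : 0 <= primitive p x by exact: Rintegral_ge0.
have P0 y : 0 <= F y by exact: primitive_ge0.
have -> : primitive h x = F x + s * primitive p x.
  have ix : mu.-integrable `]0, x[ (EFin \o g) by exact: (primitive_integrable tw).
  have mx : measurable (`]0, x[%classic : set (measurableTypeR R)) by exact: measurable_itv.
  have ipx : mu.-integrable `]0, x[ (EFin \o p).
    by apply: integrableS integrable_p => //; apply: subset_oo_itv; exact: ltW.
  rewrite /F /primitive -RintegralZl // -RintegralD //.
  exact: integrable_scale mx ipx.
case: ifP => [bx|_]; last first.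
  rewrite mulr0 addr0 ler_pM2r // ler_pXn2r ?nnegrE ?addr_ge0 ?mulr_ge0 //.
  by rewrite lerDl mulr_ge0.
rewrite primitive_p ?(ltW (le_lt_trans t1b bx)) // -mulrDl ler_pM2r //.
have L0 : 0 <= L by rewrite -(primitive_p (lexx _)); exact: Rintegral_ge0.
have Fbx : F b <= F x by apply: (primitive_le tw) => //; exact: ltW.
rewrite (_ : (F x + s * L) ^+ 2 = F x ^+ 2 + 2 * s * F x * L + (s * L) ^+ 2); last by ring.
rewrite -addrA lerD2l; apply: ler_wpDr; first exact: sqr_ge0.
by rewrite ler_wpM2r // ler_wpM2l // mulr_ge0.
Qed.

End perturb.
End hardy_perturb.

Section hardy_strict.
Context {R : realType}.
Local Notation mu := (@lebesgue_measure R).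
Implicit Types (a b t x y A : R) (w D g : R -> R).

(** Test with the constant function 1. *)
Lemma hardy_gt0 a w D A : 0 < a -> tame a w D -> hardy_inequality a w A -> 0 < A.
Proof.
move=> a0 tw hw; have [_ w0 iw _ _] := tw.
pose I : set (measurableTypeR R) := `]0, a[%classic.
have mI : measurable I by exact: measurable_itv.
pose one : R -> R := fun=> 1.
have one0 x : 0 <= one x by exact: ler01.
have m1 : measurable_fun I one by exact: measurable_cst.
have i1 : mu.-integrable I (EFin \o (fun x => one x ^+ 2 * w x)).
  by apply: eq_integrable iw => // x _ /=; rewrite /one expr1n mul1r.
have E1 : \int[mu]_(x in I) (one x ^+ 2 * w x) = \int[mu]_(x in I) w x.
  by apply: eq_Rintegral => x _; rewrite /one expr1n mul1r.
pose b := a / 2; have [b0 ba] : 0 < b /\ b < a by rewrite /b; split; lra.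
have W0 := tail_mass_gt0 tw b0 ba.
have itw := integrable_if_lt b iw.
have P1 x : 0 < x -> primitive one x = x.
  move=> x0; rewrite /primitive Rintegral_cst //= lebesgue_measure_itv /= lte_fin x0.
  by rewrite /= mul1r subr0.
have H := hw _ m1 one0 i1.
have Z0 : 0 < \int[mu]_(x in I) w x.
  apply: lt_le_trans W0 _; apply: le_Rintegral => // x.
  by rewrite /I /= in_itv /= => xa; case: ifP => // _; exact/ltW/w0.
suff : 0 < A * \int[mu]_(x in I) w x by rewrite pmulr_lgt0.
rewrite -E1; apply: lt_le_trans H.
apply: (@lt_le_trans _ _ (b ^+ 2 * tail_mass a b w)).
  by rewrite mulr_gt0 // exprn_gt0.
rewrite /tail_mass -RintegralZl //; apply: le_Rintegral => //.
- exact: integrable_scale mI itw.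
- exact: (primitive_sqr_integrable tw m1 one0 i1).
move=> x; rewrite /I /= in_itv /= => /andP[x0 xa]; rewrite P1 //.
have wx : 0 < w x by rewrite w0 // x0.
case: ifP => [bx|_]; last by rewrite mulr0 mulr_ge0 ?sqr_ge0 // ltW.
by rewrite ler_pM2r // ler_pXn2r ?nnegrE // ltW.
Qed.

(** Left of [b] the primitive is at most its value at [b]; right of [b] the pointwise
    bound [primitive_sqr_le] applies. *)
Lemma energy_concentrated a w D b g : 0 < b -> b < a -> tame a w D ->
  measurable_fun `]0, a[ g -> (forall x, 0 <= g x) ->
  mu.-integrable `]0, a[ (EFin \o (fun x => g x ^+ 2 * w x)) ->
  \int[mu]_(x in `]0, a[) (primitive g x ^+ 2 * w x) <=
  primitive g b ^+ 2 * \int[mu]_(x in `]0, a[) w x +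
  a * \int[mu]_(x in `]0, a[) (g x ^+ 2 * w x) * tail_mass a b D.
Proof.
move=> b0 ba tw mg g0 ig; have [_ w0 iw iD _] := tw.
pose I : set (measurableTypeR R) := `]0, a[%classic.
have mI : measurable I by exact: measurable_itv.
have itD := integrable_if_lt b iD.
set E := \int[mu]_(x in _) (g x ^+ 2 * w x).
have E0 : 0 <= E.
  by apply: Rintegral_ge0 => x /=; rewrite in_itv /= => /w0/ltW wx; rewrite mulr_ge0 ?sqr_ge0.
rewrite /tail_mass -RintegralZl // -RintegralZl //.
have i1 := integrable_scale (primitive g b ^+ 2) mI iw.
have i2 := integrable_scale (a * E) mI itD.
rewrite -RintegralD //; apply: le_Rintegral => //.
- exact: (primitive_sqr_integrable tw mg g0 ig).
- exact: integrable_add mI i1 i2.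
move=> x; rewrite /= in_itv /= => xI; have /andP[x0 xa] := xI; have wx := w0 x xI.
case: ifP => [bx|bx].
  apply: ler_wpDl; first by rewrite mulr_ge0 ?sqr_ge0 // ltW.
  by rewrite [leRHS]mulrAC; exact: (primitive_sqr_le tw mg g0 ig).
rewrite mulr0 addr0 ler_pM2r // ler_pXn2r ?nnegrE ?primitive_ge0 //.
by apply: (primitive_le tw) => //; rewrite leNgt bx.
Qed.

(** The family of inequalities of [hardy_perturb] at [s = sqrt (d E)], where [d E]
    bounds the defect of [g]; [P1] and [P2] are the values of the primitive at
    [t1] and [b]. *)
Lemma perturbation_bound (P1 P2 A L W k d E : R) :
  0 <= P1 -> 0 <= P2 -> 0 < A -> 0 <= L -> 0 < k -> 0 < d -> 0 < E -> 0 < L * W ->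
  k * P1 ^+ 2 <= d * E ->
  (forall s, 0 <= s -> 2 * s * P2 * L * W <= d * E + A * (2 * s * P1 + s ^+ 2 * L)) ->
  P2 ^+ 2 <= ((1 + A * (2 * (Num.sqrt k)^-1 + L)) / (2 * (L * W))) ^+ 2 * (d * E).
Proof.
move=> P10 P20 A0 L0 k0 d0 E0 LW0 kP H.
have dE : 0 < d * E by rewrite mulr_gt0.
pose s := Num.sqrt (d * E).
have s0 : 0 < s by rewrite sqrtr_gt0.
have sE : s ^+ 2 = d * E by rewrite sqr_sqrtr // ltW.
pose r := Num.sqrt k.
have r0 : 0 < r by rewrite sqrtr_gt0.
have rE : r ^+ 2 = k by rewrite sqr_sqrtr // ltW.
have X0 : 0 < 2 * (L * W) by rewrite mulr_gt0.
have P1s : P1 <= r^-1 * s.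
  rewrite ler_pdivlMl // -(@ler_pXn2r _ 2) ?nnegrE ?mulr_ge0 // ?(ltW r0) ?(ltW s0) //.
  by rewrite exprMn rE sE.
have := H s (ltW s0); rewrite -sE => {}H.
rewrite -exprMn ler_pXn2r ?nnegrE //; last first.
  rewrite mulr_ge0 ?(ltW s0) // divr_ge0 ?(ltW X0) //.
  by rewrite addr_ge0 // mulr_ge0 ?(ltW A0) // addr_ge0 // mulr_ge0 // invr_ge0 ltW.
rewrite mulrAC ler_pdivlMr // -(ler_pM2l s0).
have -> : s * (P2 * (2 * (L * W))) = 2 * s * P2 * L * W by ring.
apply: le_trans H _.
rewrite (_ : s * (_ * s) = s ^+ 2 + A * (2 * s * (r^-1 * s) + s ^+ 2 * L)); last by rewrite -/r; ring.
rewrite lerD2l ler_pM2l // lerD2r ler_pM2l // mulr_gt0 //.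
Qed.

(** If the constant [A - d] fails for [g], the defect of [g] in the Hardy inequality
    is less than [d] times its energy [E]. Then the primitive is at most a multiple
    of [sqrt (d E)] at [b] by [perturbation_bound], and [energy_concentrated] bounds
    the left-hand side by [A E / 2] when [b] is close to [a] and [d] is small. *)
Lemma hardy_strict a w D A t1 k : 0 < t1 -> t1 < a -> tame a w D -> 0 < k ->
  (forall g, measurable_fun `]0, a[ g -> (forall x, 0 <= g x) ->
    mu.-integrable `]0, a[ (EFin \o (fun x => g x ^+ 2 * w x)) ->
    \int[mu]_(x in `]0, a[) (primitive g x ^+ 2 * w x) + k * primitive g t1 ^+ 2 <=
    A * \int[mu]_(x in `]0, a[) (g x ^+ 2 * w x)) ->
  exists2 d, 0 < d & hardy_inequality a w (A - d).
Proof.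
move=> t10 t1a tw k0 hgain; have [mw w0 iw iD _] := tw.
have a0 : 0 < a by apply: lt_trans t1a.
have hw : hardy_inequality a w A.
  move=> g mg g0 ig; apply: le_trans (hgain g mg g0 ig); rewrite lerDl.
  by rewrite mulr_ge0 ?sqr_ge0 // ltW.
have A0 := hardy_gt0 a0 tw hw.
have D0 x : 0 < x < a -> 0 <= D x by move=> xa; rewrite ltW // (tame_gt0 tw).
(* this makes the part of the integral beyond b at most A E / 4 *)
have e0 : 0 < A / (4 * a) by rewrite divr_gt0 // mulr_gt0.
have [b /andP[t1b ba] De] := tail_mass_small t10 t1a e0 D0 iD.
have b0 : 0 < b by apply: lt_le_trans t1b.
pose L := primitive (fun x => (w x)^-1) t1.
pose W := tail_mass a b w.
have W0 : 0 < W by exact: tail_mass_gt0 tw b0 ba.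
have L0 : 0 < L by exact: resistance_gt0 t10 t1a tw.
pose Z := \int[mu]_(x in `]0, a[) w x.
have Z0 : 0 <= Z by apply: Rintegral_ge0 => y /=; rewrite in_itv /= => /w0/ltW.
pose C := ((1 + A * (2 * (Num.sqrt k)^-1 + L)) / (2 * (L * W))) ^+ 2.
have C0 : 0 <= C by exact: sqr_ge0.
have CZ : 0 < 4 * (C * Z + 1) by rewrite mulr_gt0 // ltr_wpDl // mulr_ge0.
(* the second bound makes the part before b at most A E / 4, and the first
   one gives A / 2 <= A - d *)
pose d := Num.min (A / 2) (A / (4 * (C * Z + 1))).
have d0 : 0 < d by rewrite lt_min !divr_gt0.
exists d => // g mg g0 ig.
set E := \int[mu]_(x in _) (g x ^+ 2 * w x).
set Q := \int[mu]_(x in _) (primitive g x ^+ 2 * w x).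
have E0 : 0 <= E.
  by apply: Rintegral_ge0 => x /=; rewrite in_itv /= => /w0/ltW wx; rewrite mulr_ge0 ?sqr_ge0.
have P0 x : 0 <= primitive g x by exact: primitive_ge0.
have gainE : Q + k * primitive g t1 ^+ 2 <= A * E by exact: hgain mg g0 ig.
have [//|gap] := leP Q ((A - d) * E).
have QA : Q <= A * E by exact: hw mg g0 ig.
have En : E != 0 by apply: contraTneq gap => E0'; rewrite -leNgt; move: QA; rewrite E0' !mulr0.
have {En} Ep : 0 < E by rewrite lt0r En.
have kP : k * primitive g t1 ^+ 2 <= d * E.
  by move: gainE gap; rewrite mulrBl; clear; lra.
have flux s : 0 <= s -> 2 * s * primitive g b * L * W <=
    d * E + A * (2 * s * primitive g t1 + s ^+ 2 * L).
  move=> s0; have := hardy_perturb tw hw t10 t1b ba s0 mg g0 ig.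
  by rewrite -/L -/W -/E -/Q; move: gap; rewrite mulrBl -[E + _ + _]addrA mulrDr; clear; lra.
have Pb := perturbation_bound (P0 t1) (P0 b) A0 (ltW L0) k0 d0 Ep (mulr_gt0 L0 W0) kP flux.
have conc : Q <= primitive g b ^+ 2 * Z + a * E * tail_mass a b D.
  exact: energy_concentrated b0 ba tw mg g0 ig.
suff : Q <= (A - d) * E by rewrite leNgt gap.
apply: (le_trans conc).
have T1 : primitive g b ^+ 2 * Z <= A * E / 4.
  apply: le_trans (ler_wpM2r Z0 Pb) _; rewrite -/C.
  have dC : d * (4 * (C * Z + 1)) <= A.
    by rewrite -ler_pdivlMr // /d ge_min lexx orbT.
  have : C * (d * E) * Z * 4 <= A * E.
    apply: le_trans (ler_wpM2r E0 dC).
    rewrite (_ : d * _ * E = C * (d * E) * Z * 4 + 4 * (d * E)); last by ring.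
    by rewrite lerDl mulr_ge0 // mulr_ge0 // ltW.
  by clear; lra.
have T2 : a * E * tail_mass a b D <= A * E / 4.
  have aE : 0 <= a * E by rewrite mulr_ge0 // ltW.
  apply: le_trans (ler_wpM2l aE De) _.
  by rewrite le_eqVlt; apply/orP; left; apply/eqP; field; rewrite gt_eqF.
have T3 : A * E / 2 <= (A - d) * E.
  rewrite mulrAC ler_wpM2r //.
  have : d <= A / 2 by rewrite /d ge_min lexx.
  by clear; lra.
by move: T1 T2 T3; rewrite -/Z -/E; clear; lra.
Qed.

End hardy_strict.

(** * Gibbs measures and reflections *)

Section density.
Local Open Scope ereal_scope.
Context d (T : measurableType d) (R : realType).
Variables (mu nu : {measure set T -> \bar R}) (p : T -> R).
Hypothesis mp : measurable_fun setT p.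
Hypothesis p0 : forall x, (0 <= p x)%R.
Hypothesis nuE : forall A, measurable A -> nu A = \int[mu]_(x in A) (p x)%:E.

Import HBNNSimple.

Let density_indic E : measurable E ->
  \int[nu]_x (\1_E x)%:E = \int[mu]_x ((\1_E x)%:E * (p x)%:E).
Proof.
move=> mE; rewrite integral_indic // setIT nuE // integral_mkcond.
apply: eq_integral => x _; rewrite patchE indicE.
by case: ifP => _; rewrite ?mul1e ?mul0e.
Qed.

Let density_nnsfun (f : {nnsfun T >-> R}) :
  \int[nu]_x (f x)%:E = \int[mu]_x ((f x)%:E * (p x)%:E).
Proof.
under [LHS]eq_integral do rewrite fimfunE -fsumEFin//.
rewrite [LHS]ge0_integral_fsum//; last 2 first.
  - by move=> r; exact/measurable_EFinP/measurableT_comp.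
  - by move=> n x _; rewrite EFinM nnfun_muleindic_ge0.
under [RHS]eq_integral.
  move=> x xD; rewrite fimfunE -fsumEFin// muleC ge0_mule_fsumr; last first.
    by move=> r; rewrite EFinM nnfun_muleindic_ge0.
  over.
rewrite [RHS]ge0_integral_fsum//; last 2 first.
  - move=> r; apply: emeasurable_funM; first exact/measurable_EFinP.
    by apply/measurable_EFinP/measurableT_comp.
  - move=> n x _; rewrite EFinM mule_ge0//; last by rewrite nnfun_muleindic_ge0.
    by rewrite lee_fin.
apply: eq_fsbigr => r _.
rewrite integralZl_indic_nnsfun//= density_indic//.
under [RHS]eq_integral do rewrite EFinM muleCA.
have [r0|r0] := leP 0%R r.
  rewrite [RHS]ge0_integralZl//.
  - by congr (_ * _); apply: eq_integral => x _; rewrite muleC.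
  - apply: emeasurable_funM; first exact/measurable_EFinP.
    exact/measurable_EFinP/measurable_indic.
  - by move=> x _; rewrite mule_ge0 // lee_fin.
rewrite (_ : f @^-1` [set r] = set0); last first.
  by apply/preimage10 => -[x _ fx]; move: r0; rewrite ltNge -fx => /negP; apply.
rewrite !integral0_eq ?mule0 // => x _; by rewrite indic0 ?mul0e ?mule0 ?mul0e.
Qed.

(** Approximation by simple functions, starting from indicators. *)
Lemma ge0_integral_density (f : T -> \bar R) :
  measurable_fun setT f -> (forall x, 0 <= f x) ->
  \int[nu]_x f x = \int[mu]_x (f x * (p x)%:E).
Proof.
move=> mf f0.
pose f_ := nnsfun_approx measurableT mf.
transitivity (lim (\int[nu]_x (f_ n x)%:E @[n --> \oo])).
  rewrite -monotone_convergence//=.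
  - apply: eq_integral => ? /[!inE] xD; apply/esym/cvg_lim => //=.
    exact: cvg_nnsfun_approx.
  - by move=> n; exact/measurable_EFinP/measurable_funTS.
  - by move=> n ? _; rewrite lee_fin.
  - by move=> ? _ ? ? mn; rewrite lee_fin; exact/lefP/nd_nnsfun_approx.
under eq_fun do rewrite density_nnsfun.
rewrite -monotone_convergence//=.
- apply: eq_integral => x _; apply/cvg_lim => //=.
  apply: cvgeZr => //; exact: cvg_nnsfun_approx.
- move=> n; apply: emeasurable_funM; last exact/measurable_EFinP.
  exact/measurable_EFinP/measurable_funTS.
- by move=> n ? _; rewrite mule_ge0 // lee_fin.
- move=> x _ ? ? mn; apply: lee_wpmul2r; first by rewrite lee_fin.
  by rewrite lee_fin; exact/lefP/nd_nnsfun_approx.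
Qed.

End density.

Section reflection.
Context {R : realType}.
Local Notation mu := (@lebesgue_measure R).
Implicit Types (a : R) (f : R -> \bar R).
Local Open Scope ereal_scope.

Lemma ge0_integral_oppr (A : set (measurableTypeR R)) f : measurable A ->
  measurable_fun A f -> (forall x, A x -> 0 <= f x) ->
  \int[mu]_(x in A) f x = \int[mu]_(x in -%R @^-1` A) f (- x)%R.
Proof.
move=> mA mf f0.
rewrite -[RHS](@ge0_integral_pushforward _ _ _ _ R (-%R : measurableTypeR R -> measurableTypeR R) _ mu A f) //.
- by apply: eq_measure_integral => B mB _; (exact: lebesgue_measureN || exact/esym/lebesgue_measureN).
- by move=> x; rewrite inE => Ax; exact: f0.
Qed.

Lemma oppr_itv_left a : -%R @^-1` `](- a)%R, 0%R[%classic = `]0%R, a[%classic.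
Proof.
by apply/seteqP; split => x /=; rewrite !in_itv /= => /andP[? ?]; apply/andP; split; lra.
Qed.

Lemma integral_oppr_itv a f : measurable_fun `](- a)%R, 0%R[ f ->
  \int[mu]_(x in `](- a)%R, 0%R[) f x = \int[mu]_(x in `]0%R, a[) f (- x)%R.
Proof.
move=> mf; rewrite integralE [RHS]integralE; congr (_ - _).
  rewrite (ge0_integral_oppr _ (measurable_funepos mf)) ?oppr_itv_left //.
  by apply: eq_integral => x _; rewrite !funeposE.
rewrite (ge0_integral_oppr _ (measurable_funeneg mf)) ?oppr_itv_left //.
by apply: eq_integral => x _; rewrite !funenegE.
Qed.

Lemma ge0_integral_symmetric a f : (0 < a)%R -> measurable_fun `](- a)%R, a[ f ->
  (forall x, (- a < x < a)%R -> 0 <= f x) ->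
  \int[mu]_(x in `](- a)%R, a[) f x =
  \int[mu]_(x in `]0%R, a[) f x + \int[mu]_(x in `]0%R, a[) f (- x)%R.
Proof.
move=> a0 mf f0.
have na0 : (- a < 0)%R by rewrite oppr_lt0.
have E : `](- a)%R, a[%classic = `](- a)%R, 0%R] `|` `]0%R, a[ :> set R.
  by rewrite -itv_bndbnd_setU // bnd_simp // ltW.
have s1 : `](- a)%R, 0%R] `<=` `](- a)%R, a[ by rewrite E; exact: subsetUl.
have s2 : `]0%R, a[ `<=` `](- a)%R, a[ by rewrite E; exact: subsetUr.
rewrite E ge0_integral_setU //=.
- rewrite addeC; congr (_ + _); rewrite -integral_itv_bndo_bndc; last first.
    by apply: measurable_funS mf => //; apply: subset_itvl; rewrite bnd_simp ltW.
  apply: integral_oppr_itv.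
  by apply: measurable_funS mf => //; apply: subset_itvl; rewrite bnd_simp ltW.
- by move: mf; rewrite E.
- move=> x xU; apply: f0; have : `](- a)%R, a[%classic x by rewrite E.
  by rewrite /= in_itv.
- apply/disj_setPS => x [/=]; rewrite !in_itv /= => /andP[_ x0] /andP[x1 _].
  by move: x1; rewrite ltNge x0.
Qed.

End reflection.

Section variance.
Local Open Scope ereal_scope.

(** The difference of the two sides is the square of the mean of [f] minus [c]. *)
Lemma variance_le_second_moment d (T : measurableType d) (R : realType)
    (P : probability T R) (U : set T) (f : T -> R) (c : R) :
  measurable U -> P U = 1 -> measurable_fun U f ->
  \int[P]_(x in U) (f x ^+ 2)%:E < +oo ->
  \int[P]_(x in U) (f x ^+ 2)%:E - (\int[P]_(x in U) (f x)%:E) ^+ 2 <=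
  \int[P]_(x in U) ((f x - c) ^+ 2)%:E.
Proof.
move=> mU PU mf f2.
have mf2 : measurable_fun U (fun x => f x ^+ 2)%R by exact: measurable_funX.
have i2 : P.-integrable U (EFin \o (fun x => f x ^+ 2)%R).
  apply/integrableP; split; first exact/measurable_EFinP.
  under eq_integral do rewrite /= ger0_norm ?sqr_ge0 //.
  by [].
have ic k : P.-integrable U (EFin \o (fun=> k)).
  by apply: finite_measure_integrable_cst.
have i1 : P.-integrable U (EFin \o f).
  have h : P.-integrable U (EFin \o (fun x => f x ^+ 2 + 1)%R).
    by apply: eq_integrable (integrableD mU i2 (ic 1%R)) => // x _ /=.
  apply: le_integrable h => //; first exact/measurable_EFinP.
  move=> x _; have H0 : (0 <= f x ^+ 2 + 1)%R by rewrite addr_ge0 ?sqr_ge0.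
  rewrite /= lee_fin (ger0_norm H0) -(real_normK (num_real (f x))).
  have := normr_ge0 (f x); move: `|f x|%R => t t0.
  have : (0 <= (t - 2^-1) ^+ 2)%R by exact: sqr_ge0.
  nra.
pose m := (\int[P]_(x in U) f x)%R.
pose s := (\int[P]_(x in U) (f x ^+ 2))%R.
have -> : \int[P]_(x in U) (f x)%:E = m%:E by rewrite /m /Rintegral fineK // integrable_fin_num.
have -> : \int[P]_(x in U) (f x ^+ 2)%:E = s%:E by rewrite /s /Rintegral fineK // integrable_fin_num.
have i1c : P.-integrable U (EFin \o (fun x => - (2 * c) * f x)%R).
  by apply: eq_integrable (integrableZl mU (- (2 * c))%R i1) => // x _ /=.
have i3 : P.-integrable U (EFin \o (fun x => f x ^+ 2 + - (2 * c) * f x)%R).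
  by apply: eq_integrable (integrableD mU i2 i1c) => // x _ /=.
have E : (\int[P]_(x in U) ((f x - c) ^+ 2) = s - 2 * c * m + c ^+ 2)%R.
  transitivity (\int[P]_(x in U) ((f x ^+ 2 + - (2 * c) * f x) + c ^+ 2))%R.
    by apply: eq_Rintegral => x _; ring.
  rewrite RintegralD // RintegralD // RintegralZl // Rintegral_cst //.
  rewrite -/m -/s (_ : fine _ = 1%R); last by rewrite -[RHS]/(fine 1%E) -PU.
  by ring.
have i4 : P.-integrable U (EFin \o (fun x => (f x - c) ^+ 2)%R).
  apply: eq_integrable (integrableD mU i3 (ic (c ^+ 2)%R)) => // x _ /=.
  by rewrite -EFinD; congr EFin; ring.
have -> : \int[P]_(x in U) ((f x - c) ^+ 2)%:E = (s - 2 * c * m + c ^+ 2)%:E.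
  by rewrite -E /Rintegral fineK // integrable_fin_num.
rewrite -EFin_expe -EFinB lee_fin -subr_ge0.
by rewrite (_ : _ - _ = (m - c) ^+ 2)%R ?sqr_ge0 //; ring.
Qed.

End variance.

Definition boltzmann {R : realType} (H : R -> R) (beta x : R) : R :=
  expR (- (beta * H x)).

Section gibbs.
Context {R : realType}.
Local Notation mu := (@lebesgue_measure R).
Variables (a beta : R) (H D : R -> R).
Hypothesis a0 : 0 < a.
Local Notation U := (`]- a, a[%classic : set (measurableTypeR R)).
Local Notation I := (`]0, a[%classic : set (measurableTypeR R)).
Hypothesis mH : measurable_fun U H.
Hypothesis H_even : forall x, - a < x < a -> H (- x) = H x.
Hypothesis tw : tame a (boltzmann H beta) D.
Local Notation rho := (boltzmann H beta).

Let mU : measurable U. Proof. exact: measurable_itv. Qed.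
Let mI : measurable I. Proof. exact: measurable_itv. Qed.

Let z := \int[mu]_(x in I) rho x.

Lemma measurable_boltzmann : measurable_fun U rho.
Proof.
apply: measurableT_comp => //; apply: measurableT_comp => //.
by apply: measurable_funM => //; exact: measurable_cst.
Qed.

Lemma boltzmann_even x : I x -> rho (- x) = rho x.
Proof.
rewrite /= in_itv /= => /andP[x0 xa]; rewrite /boltzmann H_even //.
by rewrite xa andbT (lt_trans _ x0) // oppr_lt0.
Qed.

Lemma half_mass_gt0 : 0 < z.
Proof.
have [_ w0 iw _ _] := tw.
have [b0 ba] : 0 < a / 2 /\ a / 2 < a by split; move: a0; lra.
apply: lt_le_trans (tail_mass_gt0 tw b0 ba) _; apply: le_Rintegral => //.
  exact: integrable_if_lt.
by move=> x; rewrite /= in_itv /= => /w0/ltW wx; case: ifP.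
Qed.

(** Both halves of [(-a, a)] are brought to [(0, a)], where [rho] is unchanged by
    evenness. *)
Lemma ge0_integral_fold (h : R -> R) : measurable_fun U h ->
  (forall x, - a < x < a -> 0 <= h x) ->
  (\int[mu]_(x in U) (h x * rho x)%:E = \int[mu]_(x in I) (h x * rho x)%:E +
     \int[mu]_(x in I) (h (- x)%R * rho x)%:E)%E.
Proof.
move=> mh h0.
rewrite (@ge0_integral_symmetric _ a (fun x => (h x * rho x)%:E) a0).
- congr (_ + _)%E; apply: eq_integral => x; rewrite inE => Ix.
  by rewrite boltzmann_even.
- apply/measurable_EFinP; apply: measurable_funM => //; exact: measurable_boltzmann.
- by move=> x xa; rewrite lee_fin mulr_ge0 ?h0 // expR_ge0.
Qed.

Lemma partition_functionE : partition_function U H beta = (2 * z)%:E.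
Proof.
have [_ w0 iw _ _] := tw.
have := @ge0_integral_fold (fun=> 1) (measurable_cst _) (fun _ _ => ler01).
rewrite (_ : (\int[mu]_(x in I) (1 * rho x)%:E)%E = z%:E); last first.
  rewrite /z /Rintegral fineK ?integrable_fin_num //.
  by apply: eq_integral => x _; rewrite mul1r.
rewrite /partition_function; under eq_integral do rewrite mul1r.
by move=> ->; rewrite -EFinD; congr EFin; ring.
Qed.

Lemma partition_function_pos : (0 < partition_function U H beta < +oo)%E.
Proof. by rewrite partition_functionE lte_fin mulr_gt0 ?half_mass_gt0 //= ltry. Qed.

Lemma gibbs_integral (h : R -> R) : measurable_fun U h ->
  (forall x, - a < x < a -> 0 <= h x) ->
  (\int[gibbs U H beta]_(x in U) (h x)%:E =
   (2 * z)^-1%:E * \int[mu]_(x in U) (h x * rho x)%:E)%E.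
Proof.
move=> mh h0.
have [P PE] := gibbs_is_probability mU mH partition_function_pos.
rewrite -PE.
have md : measurable_fun U (gibbs_density U H beta).
  by apply: measurable_funM; [exact: measurable_cst|exact: measurable_boltzmann].
pose d := gibbs_density U H beta \_ U.
have mdT : measurable_fun setT d by exact: (measurable_restrictT _ mU).1 md.
have d0 x : 0 <= d x by rewrite /d patchE; case: ifP => // _; exact: gibbs_density_ge0.
have Pd (A : set (measurableTypeR R)) : measurable A ->
    (P A = \int[mu]_(x in A) (d x)%:E)%E.
  move=> mA; rewrite PE /gibbs integral_mkcond [RHS]integral_mkcond.
  apply: eq_integral => x _; rewrite !patchE in_setI /d patchE.
  by case: (x \in U) => //=; case: (x \in A).
have mhT : measurable_fun setT ((EFin \o h) \_ U).
  by apply: (measurable_restrictT _ mU).1; exact/measurable_EFinP.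
have hT0 x : (0 <= ((EFin \o h) \_ U) x)%E.
  rewrite patchE; case: ifP => // /set_mem; rewrite /= in_itv /= => xa.
  by rewrite lee_fin h0.
rewrite integral_mkcond (ge0_integral_density mdT d0 Pd mhT hT0).
rewrite -ge0_integralZl //.
- rewrite [RHS]integral_mkcond; apply: eq_integral => x _; rewrite !patchE.
  case: ifP => xU; last by rewrite mul0e.
  rewrite /d patchE xU /gibbs_density partition_functionE /= -!EFinM.
  by congr EFin; rewrite /boltzmann; ring.
- by apply/measurable_EFinP; apply: measurable_funM => //; exact: measurable_boltzmann.
- by move=> x /=; rewrite in_itv /= => xa; rewrite lee_fin mulr_ge0 ?h0 // expR_ge0.
- by rewrite lee_fin invr_ge0 mulr_ge0 // ltW // half_mass_gt0.
Qed.

End gibbs.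

(** * From Hardy to Poincare *)

Section poincare_of_hardy.
Context {R : realType}.
Local Notation mu := (@lebesgue_measure R).
Variables (a beta : R) (H D : R -> R).
Hypothesis a0 : 0 < a.
Local Notation U := (`]- a, a[%classic : set (measurableTypeR R)).
Local Notation I := (`]0, a[%classic : set (measurableTypeR R)).
Hypothesis mH : measurable_fun U H.
Hypothesis H_even : forall x, - a < x < a -> H (- x) = H x.
Hypothesis tw : tame a (boltzmann H beta) D.
Local Notation rho := (boltzmann H beta).

Let mU : measurable U. Proof. exact: measurable_itv. Qed.
Let mI : measurable I. Proof. exact: measurable_itv. Qed.
Let na0 : - a < 0. Proof. by rewrite oppr_lt0. Qed.
Let IU : I `<=` U.
Proof. by move=> x /=; rewrite !in_itv /= => /andP[x0 ->]; rewrite (lt_trans _ x0). Qed.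
Let NU x : I x -> U (- x).
Proof. by rewrite /= !in_itv /= => /andP[x0 xa]; rewrite ltrN2 xa /= (lt_trans _ a0) // oppr_lt0. Qed.

Lemma measurable_fun_opp_half (h : R -> R) : measurable_fun U h ->
  measurable_fun I (fun x => h (- x)).
Proof.
move=> mh; apply: (measurable_comp (F := U)) mh _ => //.
by move=> _ [x Ix <-]; exact: NU.
Qed.

Lemma energy_finite_half (h : R -> R) : measurable_fun U h ->
  (\int[mu]_(x in U) (h x ^+ 2 * rho x)%:E < +oo)%E ->
  mu.-integrable I (EFin \o (fun x => `|h x| ^+ 2 * rho x)) /\
  mu.-integrable I (EFin \o (fun x => `|h (- x)| ^+ 2 * rho x)).
Proof.
move=> mh; have mh2 : measurable_fun U (fun x => h x ^+ 2) by exact: measurable_funX.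
rewrite (ge0_integral_fold beta a0 mH H_even mh2); last by move=> x _; exact: sqr_ge0.
move=> hoo.
have mr : measurable_fun I rho by apply: measurable_funS (measurable_boltzmann beta mH).
have fin (k : R -> R) : measurable_fun I k ->
    (\int[mu]_(x in I) (k x ^+ 2 * rho x)%:E < +oo)%E ->
    mu.-integrable I (EFin \o (fun x => `|k x| ^+ 2 * rho x)).
  move=> mk koo; apply/integrableP; split.
    apply/measurable_EFinP; apply: measurable_funM => //; apply: measurable_funX.
    exact: measurableT_comp.
  apply: le_lt_trans koo; rewrite le_eqVlt; apply/orP; left; apply/eqP.
  apply: eq_integral => x _; rewrite /= ger0_norm.
    by rewrite real_normK ?num_real.
  by rewrite mulr_ge0 ?sqr_ge0 // expR_ge0.
have pos (k : R -> R) : (0 <= \int[mu]_(x in I) (k x ^+ 2 * rho x)%:E)%E.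
  by apply: integral_ge0 => x _; rewrite lee_fin mulr_ge0 ?sqr_ge0 // expR_ge0.
split; apply: fin.
- exact: measurable_funS mh.
- by apply: le_lt_trans hoo; rewrite leeDl.
- exact: measurable_fun_opp_half.
- by apply: le_lt_trans hoo; rewrite leeDr // (pos (fun x => h (- x))).
Qed.

(** With [c] the value of [f] at 0, [(f - c)^2] is dominated on each half by the
    squared primitive of the absolute value of [g] (reflected on the left half), to
    which Hardy applies. The constant is the same on both halves because the
    weight is even. *)
Lemma poincare_of_hardy C : hardy_inequality a rho C ->
  poincare_inequality U (gibbs U H beta) C.
Proof.
move=> hC f g [wfg [mf f2] [mg g2]].
have C0 : 0 < C by exact: hardy_gt0 a0 tw hC.
have [c aef] := weak_representation a0 wfg.
have [P PE] := gibbs_is_probability mU mH (partition_function_pos a0 mH H_even tw).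
have PU : P U = 1%E.
  by rewrite PE -(gibbs_setT mU mH (partition_function_pos a0 mH H_even tw)) /gibbs setIid setIT.
have mfc : measurable_fun U (fun x => (f x - c)).
  by apply: measurable_funB => //; exact: measurable_cst.
have mfc2 : measurable_fun U (fun x => (f x - c) ^+ 2) by exact: measurable_funX.
have mg2 : measurable_fun U (fun x => g x ^+ 2) by exact: measurable_funX.
have sq0 (k : R -> R) x : - a < x < a -> 0 <= k x ^+ 2 by move=> _; exact: sqr_ge0.
have g2' : (\int[mu]_(x in U) (g x ^+ 2 * rho x)%:E < +oo)%E.
  move: g2; rewrite (gibbs_integral a0 mH H_even tw) //; last exact: sq0.
  set J := (X in (_ * X)%E).
  have z0 : 0 < (2 * \int[mu]_(x in I) rho x)^-1.
    by rewrite invr_gt0 mulr_gt0 // (half_mass_gt0 a0 tw).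
  have J0 : (0 <= J)%E.
    by apply: integral_ge0 => x _; rewrite lee_fin mulr_ge0 ?sqr_ge0 // expR_ge0.
  have [-> |Jn] := eqVneq J +oo%E; first by rewrite gt0_muley ?lte_fin.
  by move=> _; rewrite lt_neqAle Jn leey.
have [ig igN] := energy_finite_half mg g2'.
apply: (@le_trans _ _ (\int[gibbs U H beta]_(x in U) ((f x - c) ^+ 2)%:E)%E).
  by rewrite -PE; apply: variance_le_second_moment => //; rewrite PE.
have -> : (\int[gibbs U H beta]_(x in U) (`|g x| ^+ 2)%:E =
           \int[gibbs U H beta]_(x in U) (g x ^+ 2)%:E)%E.
  by congr integral; apply/funext => x; rewrite real_normK ?num_real.
rewrite !(gibbs_integral a0 mH H_even tw) //; [|exact: sq0|exact: sq0].
rewrite muleCA; apply: lee_wpmul2l.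
  by rewrite lee_fin invr_ge0 mulr_ge0 // ltW // (half_mass_gt0 a0 tw).
pose gn x := `|g x|; pose gN x := `|g (- x)|.
have mgn : measurable_fun I gn.
  by apply: measurableT_comp => //; exact: measurable_funS mg.
have mgN : measurable_fun I gN by apply: measurableT_comp => //; exact: measurable_fun_opp_half.
have gn0 x : 0 <= gn x by exact: normr_ge0.
have gN0 x : 0 <= gN x by exact: normr_ge0.
pose m1 := primitive gn \_ I; pose m2 := primitive gN \_ I.
have mm1 : measurable_fun setT m1 by exact: (measurable_restrictT _ mI).1 (measurable_primitive mgn gn0).
have mm2 : measurable_fun setT m2 by exact: (measurable_restrictT _ mI).1 (measurable_primitive mgN gN0).
(* M is the primitive of the absolute value of g started at 0 in both
   directions *)
pose M x := m1 x + m2 (- x).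
have mM : measurable_fun setT M.
  apply: measurable_funD => //; apply: measurableT_comp => //.
have Mpos x : 0 < x < a -> M x = primitive gn x.
  move=> /andP[x0 xa]; rewrite /M /m1 /m2 !patchE mem_set ?memNset ?addr0 //=.
    by rewrite in_itv /= => /andP[]; rewrite oppr_gt0 ltNge (ltW x0).
  by rewrite in_itv /= x0.
have Mneg x : 0 < x < a -> M (- x) = primitive gN x.
  move=> /andP[x0 xa]; rewrite /M /m1 /m2 opprK !patchE memNset ?mem_set ?add0r //=.
    by rewrite in_itv /= x0.
  by rewrite in_itv /= => /andP[]; rewrite oppr_gt0 ltNge (ltW x0).
have mM2 : measurable_fun U (fun x => M x ^+ 2) by apply: measurable_funX; exact: measurable_funTS.
have mr : measurable_fun U rho by exact: measurable_boltzmann.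
apply: (@le_trans _ _ (\int[mu]_(x in U) (M x ^+ 2 * rho x)%:E)%E).
  apply: ae_ge0_le_integral => //.
  - by move=> x _; rewrite lee_fin mulr_ge0 ?sqr_ge0 // expR_ge0.
  - by apply/measurable_EFinP; apply: measurable_funM.
  - by move=> x _; rewrite lee_fin mulr_ge0 ?sqr_ge0 // expR_ge0.
  - by apply/measurable_EFinP; apply: measurable_funM.
  have ae0 : {ae mu, forall x, x != 0}.
    exists [set 0]; split; [exact: measurable_set1|exact: lebesgue_measure_set1|].
    by move=> x /= /negP; rewrite negbK => /eqP.
  apply: filterS2 aef ae0; first exact: (ae_filter_ringOfSetsType mu).
  move=> x fx x0; rewrite /= in_itv /= => xU; have [fp fn] := fx xU.
  rewrite lee_fin ler_wpM2r ?expR_ge0 // -(real_normK (num_real (f x - c))).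
  have Mx : `|f x - c| <= M x.
    have /andP[ax xa] := xU.
    move: x0; rewrite neq_lt => /orP[xn|xp]; last by rewrite Mpos ?xp //; exact: fp.
    have xn' : 0 < - x < a by rewrite oppr_gt0 xn ltrNl.
    rewrite -[x in M x]opprK Mneg //; apply: le_trans (fn xn) _.
    rewrite /primitive /Rintegral.
    have mgx : measurable_fun `](- - x)%R, 0%R[ (fun y => (`|g y|)%:E).
      apply/measurable_EFinP; apply: measurableT_comp => //.
      apply: measurable_funS mg => // y /=; rewrite !in_itv /= opprK => /andP[xy y0].
      by rewrite (lt_trans ax xy) (lt_trans y0).
    by have := integral_oppr_itv mgx; rewrite opprK => ->.
  by rewrite ler_pXn2r ?nnegrE // (le_trans _ Mx).
rewrite (ge0_integral_fold beta a0 mH H_even mM2); last by move=> x _; exact: sqr_ge0.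
rewrite (ge0_integral_fold beta a0 mH H_even mg2); last by move=> x _; exact: sqr_ge0.
have half (k : R -> R) (m : R -> R) : measurable_fun I (fun x => `|k x|) ->
    mu.-integrable I (EFin \o (fun x => `|k x| ^+ 2 * rho x)) ->
    (forall x, 0 < x < a -> m x = primitive (fun x => `|k x|) x) ->
    (\int[mu]_(x in I) (m x ^+ 2 * rho x)%:E <=
     C%:E * \int[mu]_(x in I) (k x ^+ 2 * rho x)%:E)%E.
  move=> mk ik mE.
  have kn x : 0 <= `|k x| by exact: normr_ge0.
  have -> : (\int[mu]_(x in I) (m x ^+ 2 * rho x)%:E =
      (\int[mu]_(x in I) (primitive (fun x => `|k x|) x ^+ 2 * rho x)%R)%:E)%E.
    rewrite /Rintegral fineK; last first.
      exact: (integrable_fin_num mI (primitive_sqr_integrable tw mk kn ik)).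
    by apply: eq_integral => x; rewrite inE /= in_itv /= => xa; rewrite mE.
  have -> : (\int[mu]_(x in I) (k x ^+ 2 * rho x)%:E =
      (\int[mu]_(x in I) (`|k x| ^+ 2 * rho x)%R)%:E)%E.
    rewrite /Rintegral fineK; last exact: (integrable_fin_num mI ik).
    by apply: eq_integral => x _; rewrite real_normK ?num_real.
  by rewrite -EFinM lee_fin; exact: hC mk kn ik.
rewrite muleDr //; last first.
  by rewrite ge0_adde_def // inE; apply: integral_ge0 => x _; rewrite lee_fin mulr_ge0 ?sqr_ge0 // expR_ge0.
apply: leeD; first exact: half mgn ig Mpos.
exact: (half (fun x => g (- x)) (fun x => M (- x)) mgN igN Mneg).
Qed.

End poincare_of_hardy.

(** * From Poincare to Hardy *)

Section by_parts.
Context {R : realType}.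
Local Notation mu := (@lebesgue_measure R).

(** Fubini on the triangle [0 < y < x < b] for [g y * psi' x]. Plain integration by
    parts is not available since [g] is merely integrable. *)
Lemma primitive_by_parts (b : R) (g psi : R -> R) : 0 < b ->
  (forall x, 0 <= g x) -> mu.-integrable `]0, b[ (EFin \o g) ->
  (forall x, derivable psi x 1) -> continuous (derive1 psi) -> psi b = 0 ->
  (\int[mu]_(x in `]0%R, b[) (primitive g x * derive1 psi x)%:E =
   - \int[mu]_(x in `]0%R, b[) (g x * psi x)%:E)%E.
Proof.
move=> b0 g0 ig dpsi cpsi psib.
pose J : set (measurableTypeR R) := `]0, b[%classic.
have mJ : measurable J by exact: measurable_itv.
have mg : measurable_fun J g by apply/measurable_EFinP; exact: measurable_int ig.
pose gJ := g \_ J; pose pJ := derive1 psi \_ J.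
have mgJ : measurable_fun setT gJ by exact: (measurable_restrictT _ mJ).1 mg.
have mpJ : measurable_fun setT pJ.
  by apply: (measurable_restrictT _ mJ).1; apply: measurable_funTS; exact: continuous_measurable_fun.
have gJ0 x : 0 <= gJ x by rewrite /gJ patchE; case: ifP.
have [c _ cM] := EVT_max (ltW b0) (continuous_subspaceT (fun x => cvg_norm (cpsi x)) : {within `[0, b], continuous (fun x => `|derive1 psi x|)}).
set M := `|derive1 psi c| in cM.
have pJM x : `|pJ x| <= M.
  rewrite /pJ patchE; case: ifP => [|_]; last by rewrite normr0 normr_ge0.
  move=> /set_mem; rewrite /J /= in_itv /= => /andP[x0 xb].
  by apply: cM; rewrite in_itv /= !ltW.
pose k (z : R * R) : \bar R := (if z.2 < z.1 then gJ z.2 * pJ z.1 else 0)%:E.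
have mk : measurable_fun setT k.
  apply/measurable_EFinP; apply: measurable_fun_ifT => //; first exact: measurable_fun_ltr.
  by apply: measurable_funM; apply: measurableT_comp.
have igJ : mu.-integrable setT (EFin \o gJ) by exact: integrable_patch.
pose Gt := \int[mu]_x gJ x.
have intk x : (\int[mu]_y `|k (x, y)| <= (M * Gt * (\1_J x))%:E)%E.
  have [xJ|xJ] := boolP (x \in J); last first.
    rewrite indicE (negbTE xJ) mulr0 integral0_eq // => y _.
    by rewrite /k /pJ /= patchE (negbTE xJ) mulr0 if_same /= normr0.
  rewrite indicE xJ mulr1 mulrC EFinM {1}/Gt /Rintegral fineK ?integrable_fin_num //.
  rewrite -ge0_integralZr //.
  - apply: ge0_le_integral => //.
    + apply: measurableT_comp => //; exact: (measurableT_comp mk (measurable_pair1 x)).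
    + by apply: emeasurable_funM => //; exact/measurable_EFinP.
    + move=> y _; rewrite /k /= -EFinM lee_fin; case: ifP => _; last by rewrite normr0 mulr_ge0 // normr_ge0.
      by rewrite normrM (ger0_norm (gJ0 y)) ler_wpM2l.
  - exact/measurable_EFinP.
  - by move=> y _; rewrite lee_fin.
  - by rewrite lee_fin normr_ge0.
have ik : (mu \x mu)%E.-integrable setT k.
  apply/integrable12ltyP => //.
  apply: (@le_lt_trans _ _ (\int[mu]_x (M * Gt * (\1_J x))%:E)%E).
    apply: ge0_le_integral => //.
    + by move=> x _; apply: integral_ge0 => y _; exact: abse_ge0.
    + have mak : measurable_fun setT (abse \o k) by exact: measurableT_comp.
      exact: (@measurable_fun_fubini_tonelli_F _ _ _ _ R mu (abse \o k) mak (fun z => abse_ge0 _)).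
    + apply/measurable_EFinP; apply: measurable_funM => //.
  under eq_integral do rewrite EFinM.
  rewrite ge0_integralZl //.
  - rewrite integral_indic // setIT /J /= lebesgue_measure_itv /= lte_fin b0 -EFinB -EFinM.
    exact: ltry.
  - by apply/measurable_EFinP; exact: measurable_indic.
  - by rewrite lee_fin mulr_ge0 ?normr_ge0 //; apply: Rintegral_ge0.
have inner x : (\int[mu]_y k (x, y) = (((fun x => primitive g x * derive1 psi x) \_ J) x)%:E)%E.
  rewrite patchE; have [xJ|xJ] := boolP (x \in J); last first.
    by rewrite integral0_eq // => y _; rewrite /k /pJ /= patchE (negbTE xJ) mulr0 if_same.
  have := set_mem xJ; rewrite /J /= in_itv /= => /andP[x0 xb].
  have mx : measurable (`]0, x[%classic : set (measurableTypeR R)) by exact: measurable_itv.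
  have ix : mu.-integrable `]0, x[ (EFin \o g).
    by apply: integrableS ig => //; apply: subset_oo_itv; exact: ltW.
  transitivity (\int[mu]_(y in `]0%R, x[) (derive1 psi x * g y)%:E)%E.
    rewrite [RHS]integral_mkcond; apply: eq_integral => y _.
    rewrite patchE mem_setE in_itv /= /k /pJ /= patchE xJ /gJ patchE mem_setE in_itv /=.
    case: (ltP y x) => yx; last by rewrite andbF.
    rewrite (lt_trans yx xb) !andbT; case: ifP => _; first by rewrite mulrC.
    by rewrite mul0r.
  rewrite mulrC -RintegralZl // /Rintegral fineK //.
  exact: (integrable_fin_num mx (integrable_scale _ mx ix)).
have outer y : (\int[mu]_x k (x, y) = - (((fun y => g y * psi y) \_ J) y)%:E)%E.
  rewrite patchE; have [yJ|yJ] := boolP (y \in J); last first.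
    rewrite oppe0 integral0_eq // => x _.
    by rewrite /k /gJ /= patchE (negbTE yJ) mul0r if_same.
  have := set_mem yJ; rewrite /J /= in_itv /= => /andP[y0 yb].
  have my : measurable (`[y, b]%classic : set (measurableTypeR R)) by exact: measurable_itv.
  have iy : mu.-integrable `[y, b] (EFin \o derive1 psi).
    by apply: continuous_compact_integrable; [exact: segment_compact|exact: continuous_subspaceT].
  have FTC : (\int[mu]_(x in `[y, b]) (derive1 psi x)%:E = (psi b)%:E - (psi y)%:E)%E.
    have cp : continuous psi.
      by move=> x; apply/differentiable_continuous/derivable1_diffP.
    apply: (continuous_FTC2 (f := derive1 psi) (F := psi) yb); first exact: continuous_subspaceT; last by [].
    split; [by move=> x _; exact: dpsi|apply: cvg_at_right_filter; exact: cp|apply: cvg_at_left_filter; exact: cp].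
  transitivity (\int[mu]_(x in `]y, b[) (g y * derive1 psi x)%:E)%E.
    rewrite [RHS]integral_mkcond; apply: eq_integral => x _.
    rewrite patchE mem_setE in_itv /= /k /pJ /= patchE mem_setE in_itv /= /gJ patchE yJ.
    case: (ltP y x) => yx //=; rewrite (lt_trans y0 yx) /=.
    by case: ifP => // _; rewrite mulr0.
  have ms : measurable_fun `]y, b[ (fun x => (derive1 psi x)%:E).
    by apply/measurable_EFinP; apply: measurable_funTS; exact: continuous_measurable_fun.
  transitivity (g y * \int[mu]_(x in `[y, b]) derive1 psi x)%:E.
    rewrite -RintegralZl // /Rintegral fineK; last first.
      exact: (integrable_fin_num my (integrable_scale _ my iy)).
    have mgs : measurable_fun setT (fun x => (g y * derive1 psi x)%:E).
      apply/measurable_EFinP; apply: measurable_funM => //.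
      exact: continuous_measurable_fun.
    rewrite -(integral_itv_bndo_bndc (measurable_funTS mgs)).
    by rewrite -(integral_itv_obnd_cbnd (measurable_funTS mgs)).
  by rewrite /Rintegral FTC psib -EFinB /= sub0r mulrN EFinN.
have igpsi : mu.-integrable J (EFin \o (fun x => g x * psi x)).
  apply: (integrableM_continuous (p := 0) (q := b) mJ) => //.
    by move=> x; rewrite /J /= !in_itv /= => /andP[x0 xb]; rewrite !ltW.
  by move=> x; apply/differentiable_continuous/derivable1_diffP.
have igT := integrable_patch mJ igpsi.
transitivity (\int[mu]_x \int[mu]_y k (x, y))%E.
  rewrite integral_mkcond; apply: eq_integral => x _.
  by rewrite inner restrict_EFin.
rewrite (Fubini ik) [in RHS]integral_mkcond restrict_EFin -integralN; last first.
  by apply: integrable_add_def.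
by apply: eq_integral => y _; exact: outer.
Qed.
End by_parts.

Definition even_ext {R : realType} (a : R) (g : R -> R) (x : R) : R :=
  (g \_ `]0, a[) `|x|.

Definition odd_ext {R : realType} (a : R) (g : R -> R) (x : R) : R :=
  (primitive g \_ `]0, a[) x - (primitive g \_ `]0, a[) (- x).

Section odd_extension_energy.
Context {R : realType}.
Local Notation mu := (@lebesgue_measure R).
Variables (a beta : R) (H D : R -> R).
Hypothesis a0 : 0 < a.
Local Notation U := (`]- a, a[%classic : set (measurableTypeR R)).
Local Notation I := (`]0, a[%classic : set (measurableTypeR R)).
Hypothesis mH : measurable_fun U H.
Hypothesis cH : {within `]- a, a[, continuous H}.
Hypothesis H_even : forall x, - a < x < a -> H (- x) = H x.
Hypothesis tw : tame a (boltzmann H beta) D.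
Local Notation rho := (boltzmann H beta).

Let mU : measurable U. Proof. exact: measurable_itv. Qed.
Let mI : measurable I. Proof. exact: measurable_itv. Qed.
Let na0 : - a < 0. Proof. by rewrite oppr_lt0. Qed.
Let IU : I `<=` U.
Proof. by move=> x /=; rewrite !in_itv /= => /andP[x0 ->]; rewrite (lt_trans _ x0). Qed.
Let NU x : I x -> U (- x).
Proof. by rewrite /= !in_itv /= => /andP[x0 xa]; rewrite ltrN2 xa /= (lt_trans _ a0) // oppr_lt0. Qed.

Lemma Rintegral_symmetric (h : R -> R) : mu.-integrable U (EFin \o h) ->
  \int[mu]_(x in U) h x =
  \int[mu]_(x in I) h x + \int[mu]_(x in I) h (- x).
Proof.
move=> ih.
have E : U = `](- a)%R, 0%R] `|` `]0%R, a[.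
  by rewrite -itv_bndbnd_setU // bnd_simp // ltW.
have ih1 : mu.-integrable `](- a)%R, 0%R[ (EFin \o h).
  by apply: integrableS ih => //; apply: subset_itvl; rewrite bnd_simp ltW.
rewrite E Rintegral_setU //.
- rewrite addrC; congr (_ + _); rewrite -Rintegral_itv_bndo_bndc //.
  by rewrite /Rintegral (integral_oppr_itv (measurable_int _ ih1)).
- by rewrite -E.
- apply/disj_setPS => x [/=]; rewrite !in_itv /= => /andP[_ x0] /andP[x1 _].
  by move: x1; rewrite ltNge x0.
Qed.

(** On a compact set [rho] is bounded below, and [2 t <= t^2 rho + rho^-1]. *)
Lemma locally_integrable_weighted (h : R -> R) : measurable_fun U h ->
  (\int[mu]_(x in U) (h x ^+ 2 * rho x)%:E < +oo)%E ->
  locally_integrable `]- a, a[ h.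
Proof.
move=> mh h2; split; [exact: mh|exact: interval_open|move=> K KU cK].
have [->|K0] := eqVneq K set0; first by rewrite integral_set0 ltry.
have cH' : {within K, continuous (fun x => beta * H x)}.
  have cHK : {within K, continuous H} by exact: continuous_subspaceW cH.
  by move=> x; apply: cvgM; [exact: cvg_cst|exact: cHK].
have [c _ cM] := compact_EVT_max ((set0P _).1 K0) cK cH'.
have mK : measurable (K : set (measurableTypeR R)) by exact: compact_measurable.
have mr : measurable_fun K rho.
  by apply: (measurable_funS mU KU); exact: measurable_boltzmann.
have mhK : measurable_fun K h by exact: (measurable_funS mU KU).
have iK : mu.-integrable K (EFin \o (fun x => h x ^+ 2 * rho x)).
  apply/integrableP; split.
    by apply/measurable_EFinP; apply: measurable_funM => //; exact: measurable_funX.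
  apply: le_lt_trans h2; under eq_integral => x _.
    rewrite /= ger0_norm; first over.
    by rewrite mulr_ge0 ?sqr_ge0 // expR_ge0.
  apply: ge0_subset_integral => //.
  - apply/measurable_EFinP; apply: measurable_funM => //; first exact: measurable_funX.
    exact: measurable_boltzmann.
  - by move=> x _; rewrite lee_fin mulr_ge0 ?sqr_ge0 // expR_ge0.
have icK : mu.-integrable K (EFin \o (fun=> expR (beta * H c))).
  apply: continuous_compact_integrable => //.
  by apply: continuous_subspaceT => ?; exact: cvg_cst.
have : mu.-integrable K (EFin \o h).
  apply: integrable_le (integrable_add mK iK icK) => // x Kx.
  have := weighted_young `|h x| ltr01 (expR_gt0 (- (beta * H x))).
  rewrite real_normK ?num_real // mul1r invr1 mul1r -expRN opprK.
  have : expR (beta * H x) <= expR (beta * H c) by rewrite ler_expR; apply: cM; exact: mem_set.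
  have := normr_ge0 (h x); rewrite /boltzmann; lra.
by move=> /integrableP[].
Qed.

Section odd_extension.
Variable g : R -> R.
Hypothesis mg : measurable_fun I g.
Hypothesis g0 : forall x, 0 <= g x.
Hypothesis ig : mu.-integrable I (EFin \o (fun x => g x ^+ 2 * rho x)).

Let gI := g \_ I.
Let pI := primitive g \_ I.
Local Notation eg := (even_ext a g).
Local Notation og := (odd_ext a g).

Lemma measurable_even_ext : measurable_fun setT eg.
Proof.
apply: measurableT_comp => //.
exact: (measurable_restrictT _ mI).1 mg.
Qed.

Lemma measurable_odd_ext : measurable_fun setT og.
Proof.
have mp : measurable_fun setT pI.
  exact: (measurable_restrictT _ mI).1 (measurable_primitive mg g0).
by apply: measurable_funB => //; exact: measurableT_comp.
Qed.

Lemma even_extE x : I x -> eg x = g x /\ eg (- x) = g x.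
Proof.
move=> Ix; have := Ix; rewrite /= in_itv /= => /andP[x0 xa].
by rewrite /even_ext normrN gtr0_norm // /gI patchE mem_set.
Qed.

Lemma odd_extE x : I x -> og x = primitive g x /\ og (- x) = - primitive g x.
Proof.
move=> Ix; have := Ix; rewrite /= in_itv /= => /andP[x0 xa].
have nI : ~ I (- x) by rewrite /= in_itv /= => /andP[]; rewrite oppr_gt0 ltNge (ltW x0).
by rewrite /odd_ext opprK /pI !patchE mem_set // memNset // subr0 sub0r.
Qed.

Lemma even_ext_energy :
  (\int[mu]_(x in U) (eg x ^+ 2 * rho x)%:E =
   (2 * \int[mu]_(x in I) (g x ^+ 2 * rho x)%R)%:E)%E.
Proof.
rewrite (ge0_integral_fold beta a0 mH H_even (h := fun x => eg x ^+ 2)); last 2 first.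
- by apply: measurable_funX; apply: measurable_funTS; exact: measurable_even_ext.
- by move=> x _; exact: sqr_ge0.
rewrite mulr_natl mulr2n EFinD; congr (_ + _)%E.
  rewrite /Rintegral fineK; last exact: (integrable_fin_num mI ig).
  by apply: eq_integral => x; rewrite inE => Ix; rewrite (even_extE Ix).1.
rewrite /Rintegral fineK; last exact: (integrable_fin_num mI ig).
by apply: eq_integral => x; rewrite inE => Ix; rewrite (even_extE Ix).2.
Qed.

Lemma odd_ext_energy :
  (\int[mu]_(x in U) (og x ^+ 2 * rho x)%:E =
   (2 * \int[mu]_(x in I) (primitive g x ^+ 2 * rho x)%R)%:E)%E.
Proof.
have ip := primitive_sqr_integrable tw mg g0 ig.
rewrite (ge0_integral_fold beta a0 mH H_even (h := fun x => og x ^+ 2)); last 2 first.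
- by apply: measurable_funX; apply: measurable_funTS; exact: measurable_odd_ext.
- by move=> x _; exact: sqr_ge0.
rewrite mulr_natl mulr2n EFinD; congr (_ + _)%E.
  rewrite /Rintegral fineK; last exact: (integrable_fin_num mI ip).
  by apply: eq_integral => x; rewrite inE => Ix; rewrite (odd_extE Ix).1.
rewrite /Rintegral fineK; last exact: (integrable_fin_num mI ip).
by apply: eq_integral => x; rewrite inE => Ix; rewrite (odd_extE Ix).2 sqrrN.
Qed.

Lemma locally_integrable_even_ext : locally_integrable `]- a, a[ eg.
Proof.
apply: locally_integrable_weighted; last by rewrite even_ext_energy ltry.
by apply: measurable_funTS; exact: measurable_even_ext.
Qed.

Lemma locally_integrable_odd_ext : locally_integrable `]- a, a[ og.
Proof.
apply: locally_integrable_weighted; last by rewrite odd_ext_energy ltry.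
by apply: measurable_funTS; exact: measurable_odd_ext.
Qed.

End odd_extension.
End odd_extension_energy.

Section hardy_of_poincare.
Context {R : realType}.
Local Notation mu := (@lebesgue_measure R).
Variables (a beta : R) (H D : R -> R).
Hypothesis a0 : 0 < a.
Local Notation U := (`]- a, a[%classic : set (measurableTypeR R)).
Local Notation I := (`]0, a[%classic : set (measurableTypeR R)).
Hypothesis mH : measurable_fun U H.
Hypothesis cH : {within `]- a, a[, continuous H}.
Hypothesis H_even : forall x, - a < x < a -> H (- x) = H x.
Hypothesis tw : tame a (boltzmann H beta) D.
Local Notation rho := (boltzmann H beta).

Let mU : measurable U. Proof. exact: measurable_itv. Qed.
Let mI : measurable I. Proof. exact: measurable_itv. Qed.

(** A compact subset of [(-a, a)] stays away from the endpoints, and the derivative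
    of the test function vanishes on the open complement. *)
Lemma test_function_support (phi : R -> R) : test_function `]- a, a[ phi ->
  exists2 b, 0 < b < a & forall x, b <= `|x| -> phi x = 0 /\ derive1 phi x = 0.
Proof.
move=> [_ [C [cC CU phi0]]].
have [m [m0 ma mC]] : exists m, [/\ 0 <= m, m < a & forall x, C x -> `|x| <= m].
  have [->|C0] := eqVneq C set0; first by exists 0; split.
  have cn : {within C, continuous (fun x : R => `|x|)}.
    by apply: continuous_subspaceT => x; exact: norm_continuous.
  have [c cC' cM] := compact_EVT_max ((set0P _).1 C0) cC cn.
  exists `|c|; split => //; last by move=> x Cx; apply: cM; exact: mem_set.
  by move: cC' => /set_mem/CU; rewrite /= in_itv /= ltr_norml.
exists ((m + a) / 2); first by apply/andP; split; lra.
move=> x bx.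
have mx : m < `|x| by lra.
split; first by apply: phi0 => /mC; rewrite leNgt mx.
rewrite derive1E.
have near0 : \near x, (cst 0 : R -> R) x = phi x.
  have : \near x, m < `|x|.
    exact: (@norm_continuous _ _ x) _ (lt_nbhsr mx).
  apply: filterS => y my; rewrite phi0 // => /mC; by rewrite leNgt my.
by have [_ ->] := near_eq_is_derive near0 (is_derive_cst (0 : R) x (1 : R)).
Qed.

(** Integration by parts on [(0, a)], against [phi] and against its reflection; there
    is no boundary term at 0 because the primitive vanishes there. *)
Lemma weak_derivative_odd_ext (g : R -> R) :
  measurable_fun I g -> (forall x, 0 <= g x) ->
  mu.-integrable I (EFin \o (fun x => g x ^+ 2 * rho x)) ->
  is_weak_derivative `]- a, a[ (odd_ext a g) (even_ext a g).
Proof.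
move=> mg g0 ig.
have lo := locally_integrable_odd_ext a0 mH cH H_even tw mg g0 ig.
have le := locally_integrable_even_ext a0 mH cH H_even mg ig.
split=> // phi tphi.
have [b /andP[b0 ba] phib] := test_function_support tphi.
have sphi : smooth phi by have [] := tphi.
have cphi := smooth_continuous sphi.
have cphi' := smooth_continuous (smooth_derive1 sphi).
have bU : `[- b, b] `<=` `]- a, a[.
  by move=> x /=; rewrite !in_itv /= => /andP[? ?]; apply/andP; split; lra.
have mB : measurable (`[- b, b]%classic : set (measurableTypeR R)) by exact: measurable_itv.
have out x : ~ `[- b, b]%classic x -> b <= `|x|.
  by rewrite /= in_itv /= -ler_norml => /negP; rewrite -ltNge => /ltW.
have iU (h k : R -> R) : locally_integrable `]- a, a[ h -> continuous k ->
    (forall x, b <= `|x| -> k x = 0) -> mu.-integrable U (EFin \o (fun x => h x * k x)).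
  move=> lh ck k0.
  apply: (@integrable_support _ `[- b, b]%classic U) => //.
    by move=> x _ /out/k0 ->; rewrite mulr0.
  apply: (integrableM_continuous mB (@subset_refl _ _)) => //.
  exact: locally_integrable_itv lh bU.
have i1 := iU _ _ lo cphi' (fun x bx => (phib x bx).2).
have i2 := iU _ _ le cphi (fun x bx => (phib x bx).1).
pose psi x := 1 * phi ((-1) * (x - 0)).
have psiE x : psi x = phi (- x) by rewrite /psi mul1r subr0 mulN1r.
have spsi : smooth psi by exact: smooth_affine.
have psi'E x : derive1 psi x = - derive1 phi (- x).
  by rewrite derive1_affine // mul1r subr0 mulN1r mulN1r.
have psib x : b <= `|x| -> psi x = 0 /\ derive1 psi x = 0.
  rewrite -normrN => /phib[p1 p2]; by rewrite psiE psi'E p1 p2 oppr0.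
have igb : mu.-integrable `]0, b[ (EFin \o g) by exact: (primitive_integrable tw mg g0 ig).
have bI : `]0, b[ `<=` I by apply: subset_oo_itv; exact: ltW.
have parts k : smooth k -> (forall x, b <= `|x| -> k x = 0 /\ derive1 k x = 0) ->
    \int[mu]_(x in I) (primitive g x * derive1 k x) = - \int[mu]_(x in I) (g x * k x).
  move=> sk kb.
  have far x : I x -> ~ `]0, b[%classic x -> b <= `|x|.
    rewrite /= !in_itv /= => /andP[x0 _]; rewrite x0 /= => /negP; rewrite -leNgt.
    by rewrite gtr0_norm.
  rewrite (@Rintegral_support _ `]0, b[%classic I) //; last first.
    by move=> x Ix /(far x Ix)/kb[_ ->]; rewrite mulr0.
  rewrite [in RHS](@Rintegral_support _ `]0, b[%classic I) //; last first.
    by move=> x Ix /(far x Ix)/kb[-> _]; rewrite mulr0.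
  have kb0 : k b = 0 by apply: (kb b _).1; rewrite gtr0_norm.
  rewrite /Rintegral (primitive_by_parts b0 g0 igb) ?fineN //.
  - by move=> x; exact: smooth_derivable.
  - exact: smooth_continuous (smooth_derive1 sk).
have E : \int[mu]_(x in U) (odd_ext a g x * derive1 phi x) =
    - \int[mu]_(x in U) (even_ext a g x * phi x).
  rewrite (Rintegral_symmetric a0 i1) (Rintegral_symmetric a0 i2) opprD.
  congr (_ + _).
    rewrite (_ : \int[mu]_(x in I) _ = \int[mu]_(x in I) (primitive g x * derive1 phi x)).
      rewrite parts //; congr (- _); apply: eq_Rintegral => x; rewrite inE => Ix.
      by rewrite (even_extE g Ix).1.
    by apply: eq_Rintegral => x; rewrite inE => Ix; rewrite (odd_extE g Ix).1.
  rewrite (_ : \int[mu]_(x in I) _ = \int[mu]_(x in I) (primitive g x * derive1 psi x)).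
    rewrite parts //; congr (- _); apply: eq_Rintegral => x; rewrite inE => Ix.
    by rewrite (even_extE g Ix).2 psiE.
  by apply: eq_Rintegral => x; rewrite inE => Ix; rewrite (odd_extE g Ix).2 psi'E mulNr mulrN.
move: E; rewrite /Rintegral => E.
have f1 := integrable_fin_num mU i1.
have f2 := integrable_fin_num mU i2.
by rewrite -[LHS]fineK // E EFinN fineK.
Qed.

Lemma mean_odd_ext (g : R -> R) :
  measurable_fun I g -> (forall x, 0 <= g x) ->
  mu.-integrable I (EFin \o (fun x => g x ^+ 2 * rho x)) ->
  (\int[gibbs U H beta]_(x in U) (odd_ext a g x)%:E = 0)%E.
Proof.
move=> mg g0 ig.
have mo : measurable_fun U (odd_ext a g) by apply: measurable_funTS; exact: measurable_odd_ext.
have ip := primitive_sqr_integrable tw mg g0 ig.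
have iw : mu.-integrable I (EFin \o rho) by have [] := tw.
have mp := measurable_primitive mg g0.
have mr : measurable_fun I rho by have [] := tw.
have P0 x : 0 <= primitive g x by exact: primitive_ge0.
have ipr : mu.-integrable I (EFin \o (fun x => primitive g x * rho x)).
  apply: integrable_le (integrable_add mI ip iw) => //.
    by apply: measurable_funM.
  move=> x Ix; rewrite ger0_norm ?mulr_ge0 ?expR_ge0 // -[X in _ + X]mul1r -mulrDl.
  rewrite ler_wpM2r ?expR_ge0 //.
  have : 0 <= (primitive g x - 2^-1) ^+ 2 by exact: sqr_ge0.
  nra.
pose S := \int[mu]_(x in I) (primitive g x * rho x).
have half (k : R -> R) : measurable_fun U k -> (forall x, 0 <= k x) ->
    (forall x, I x -> k x + k (- x) = primitive g x) ->
    (\int[gibbs U H beta]_(x in U) (k x)%:E = ((2 * \int[mu]_(x in I) rho x)^-1 * S)%:E)%E.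
  move=> mk k0 kE.
  have mkN := measurable_fun_opp_half a0 mk.
  have mkI : measurable_fun I k.
    apply: measurable_funS mk => //; apply: subset_itvr; by rewrite bnd_simp oppr_le0 ltW.
  rewrite (gibbs_integral a0 mH H_even tw) // EFinM; congr (_ * _)%E.
  rewrite (ge0_integral_fold beta a0 mH H_even) // -ge0_integralD //.
  - rewrite /S /Rintegral fineK; last exact: (integrable_fin_num mI ipr).
    by apply: eq_integral => x; rewrite inE => Ix; rewrite -EFinD -mulrDl kE.
  - by move=> x _; rewrite lee_fin mulr_ge0 // expR_ge0.
  - by apply/measurable_EFinP; apply: measurable_funM.
  - by move=> x _; rewrite lee_fin mulr_ge0 // expR_ge0.
  - by apply/measurable_EFinP; apply: measurable_funM.
pose kp x := Num.max (odd_ext a g x) 0.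
pose kn x := Num.max (- odd_ext a g x) 0.
have Ep : (\int[gibbs U H beta]_(x in U) (kp x)%:E = ((2 * \int[mu]_(x in I) rho x)^-1 * S)%:E)%E.
  apply: half.
  - by apply: measurable_maxr.
  - by move=> x; rewrite le_max lexx orbT.
  - move=> x Ix; rewrite /kp (odd_extE g Ix).1 (odd_extE g Ix).2.
    by rewrite max_l // max_r ?oppr_le0 // addr0.
have En : (\int[gibbs U H beta]_(x in U) (kn x)%:E = ((2 * \int[mu]_(x in I) rho x)^-1 * S)%:E)%E.
  apply: half.
  - by apply: measurable_maxr => //; exact: measurableT_comp.
  - by move=> x; rewrite le_max lexx orbT.
  - move=> x Ix; rewrite /kn (odd_extE g Ix).1 (odd_extE g Ix).2 opprK.
    by rewrite max_r ?oppr_le0 // add0r max_l.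
have [P PE] := gibbs_is_probability mU mH (partition_function_pos a0 mH H_even tw).
have -> : (\int[gibbs U H beta]_(x in U) (odd_ext a g x)%:E =
    \int[gibbs U H beta]_(x in U) (kp x)%:E - \int[gibbs U H beta]_(x in U) (kn x)%:E)%E.
  rewrite -PE [LHS]integralE.
  rewrite (_ : (fun x => (odd_ext a g x)%:E)^\+%E = (fun x => (kp x)%:E)); last first.
    by apply/funext => x; rewrite funeposE -EFin_max.
  rewrite (_ : (fun x => (odd_ext a g x)%:E)^\-%E = (fun x => (kn x)%:E)) //.
  by apply/funext => x; rewrite funenegE -EFinN -EFin_max.
by rewrite Ep En subee.
Qed.

(** The odd extension of the primitive of [g] has mean zero and even derivative, so
    in the Poincare inequality for it both sides are twice their counterparts
    in Hardy's, up to the common normalization. *)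
Lemma hardy_of_poincare C : poincare_inequality U (gibbs U H beta) C ->
  hardy_inequality a rho C.
Proof.
move=> pC g mg g0 ig.
have mo : measurable_fun U (odd_ext a g) by apply: measurable_funTS; exact: measurable_odd_ext.
have me : measurable_fun U (even_ext a g) by apply: measurable_funTS; exact: measurable_even_ext.
have mo2 : measurable_fun U (fun x => odd_ext a g x ^+ 2) by exact: measurable_funX.
have me2 : measurable_fun U (fun x => even_ext a g x ^+ 2) by exact: measurable_funX.
have Eo : (\int[gibbs U H beta]_(x in U) (odd_ext a g x ^+ 2)%:E =
   ((2 * \int[mu]_(x in I) rho x)^-1 * (2 * \int[mu]_(x in I) (primitive g x ^+ 2 * rho x)))%:E)%E.
  rewrite (gibbs_integral a0 mH H_even tw) //; last by move=> x _; exact: sqr_ge0.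
  by rewrite (odd_ext_energy a0 mH H_even tw mg g0 ig) EFinM.
have Ee : (\int[gibbs U H beta]_(x in U) (even_ext a g x ^+ 2)%:E =
   ((2 * \int[mu]_(x in I) rho x)^-1 * (2 * \int[mu]_(x in I) (g x ^+ 2 * rho x)))%:E)%E.
  rewrite (gibbs_integral a0 mH H_even tw) //; last by move=> x _; exact: sqr_ge0.
  by rewrite (even_ext_energy a0 mH H_even mg ig) EFinM.
have hH1 : H1_with_derivative U (gibbs U H beta) (odd_ext a g) (even_ext a g).
  split; first exact: weak_derivative_odd_ext.
  - by split => //; rewrite Eo ltry.
  - by split => //; rewrite Ee ltry.
have := pC _ _ hH1.
rewrite (mean_odd_ext mg g0 ig) Eo.
have -> : (\int[gibbs U H beta]_(x in U) (`|even_ext a g x| ^+ 2)%:E =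
           \int[gibbs U H beta]_(x in U) (even_ext a g x ^+ 2)%:E)%E.
  by congr integral; apply/funext => x; rewrite real_normK ?num_real.
rewrite Ee expe2 mule0 sube0 -EFinM lee_fin.
have z0 := half_mass_gt0 a0 tw.
set z := \int[mu]_(x in I) rho x in z0 *.
set P := \int[mu]_(x in I) (primitive g x ^+ 2 * rho x).
set E := \int[mu]_(x in I) (g x ^+ 2 * rho x).
have -> : (2 * z)^-1 * (2 * P) = z^-1 * P by field; rewrite gt_eqF.
have -> : C * ((2 * z)^-1 * (2 * E)) = z^-1 * (C * E) by field; rewrite gt_eqF.
by rewrite ler_pM2l // invr_gt0.
Qed.

End hardy_of_poincare.

(** * Comparing two inverse temperatures *)

Section monotone.
Context {R : realType}.

(** Induction on the exceptional points: such a point splits the interval in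
    two. *)
Lemma nondecreasing_off_finite (s : seq R) (f : R -> R) (x y : R) : x <= y ->
  {within `[x, y], continuous f} ->
  (forall z, x < z < y -> z \notin s -> derivable f z 1 /\ 0 <= derive1 f z) ->
  f x <= f y.
Proof.
elim: s x y => [|k s IHs] x y xy cf df.
  apply: (ger0_derive1_le_cc (a := x) (b := y)) => //.
  - by move=> z; rewrite in_itv /= => /df[].
  - by move=> z; rewrite in_itv /= => /df[].
  - by rewrite in_itv /= lexx.
  - by rewrite in_itv /= lexx andbT.
have [/andP[xk ky]|kxy] := boolP (x < k < y).
  apply: (@le_trans _ _ (f k)).
    apply: IHs (ltW xk) _ _.
      apply: continuous_subspaceW cf; apply: subset_itvl; rewrite bnd_simp; exact: ltW.
    move=> z /andP[xz zk] zs; apply: df; first by rewrite xz (lt_trans zk).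
    by rewrite inE negb_or zs andbT lt_eqF.
  apply: IHs (ltW ky) _ _.
    apply: continuous_subspaceW cf; apply: subset_itvr; rewrite bnd_simp; exact: ltW.
  move=> z /andP[kz zy] zs; apply: df; first by rewrite zy (lt_trans xk).
  by rewrite inE negb_or zs andbT gt_eqF.
apply: IHs => // z xzy zs; apply: df => //; rewrite inE negb_or zs andbT.
by apply: contra kxy => /eqP <-.
Qed.

End monotone.

Section comparison.
Context {R : realType}.
Local Notation mu := (@lebesgue_measure R).

Lemma hardy_finite (a : R) (w D : R -> R) : tame a w D ->
  hardy_inequality a w (a * \int[mu]_(x in `]0, a[) D x).
Proof.
move=> tw g mg g0 ig; have [_ w0 _ iD _] := tw.
set E := \int[mu]_(x in _) (g x ^+ 2 * w x).
have mI : measurable (`]0, a[%classic : set (measurableTypeR R)) by exact: measurable_itv.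
rewrite (_ : a * _ * E = \int[mu]_(x in `]0, a[) (a * E * D x)); last first.
  by rewrite RintegralZl // mulrAC.
apply: le_Rintegral => //.
- exact: (primitive_sqr_integrable tw mg g0 ig).
- exact: integrable_scale mI iD.
- move=> x; rewrite /= in_itv /= => xa; rewrite [leRHS]mulrAC.
  exact: (primitive_sqr_le tw mg g0 ig).
Qed.

Variables (a : R) (H : R -> R).
Hypothesis a0 : 0 < a.
Hypothesis cH : {within `]- a, a[, continuous H}.
Hypothesis H_even : forall x, - a < x < a -> H (- x) = H x.

Let mU : measurable (`]- a, a[%classic : set (measurableTypeR R)).
Proof. exact: measurable_itv. Qed.

Let mH : measurable_fun (`]- a, a[%classic : set (measurableTypeR R)) H.
Proof. exact: subspace_continuous_measurable_fun mU cH. Qed.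

(** The factor between the two weights is [boltzmann H (gamma - beta)], which is
    nonincreasing and drops strictly between [t1] and [t2]. The constant at [beta]
    is a positive real attained in the Poincare inequality, hence in Hardy's, so
    [hardy_gain] and [hardy_strict] apply to it. *)
Lemma poincare_constant_lt (beta gamma t1 t2 : R) (D D' : R -> R) :
  tame a (boltzmann H beta) D -> tame a (boltzmann H gamma) D' ->
  (forall y x, 0 < y -> y <= x -> x < a -> (gamma - beta) * H y <= (gamma - beta) * H x) ->
  0 < t1 -> t1 < t2 -> t2 < a -> (gamma - beta) * H t1 < (gamma - beta) * H t2 ->
  (poincare_constant `](- a)%R, a[%classic H gamma <
   poincare_constant `](- a)%R, a[%classic H beta)%E.
Proof.
move=> tb tg mono t10 t12 t2a Ht.
have hp C := poincare_of_hardy (C := C) a0 mH H_even tb.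
have ph C := @hardy_of_poincare _ _ _ _ _ a0 mH cH H_even tb C.
have [c cE] : exists c, poincare_constant `]- a, a[%classic H beta = c%:E.
  set p := poincare_constant _ _ _.
  have p0 : (0 <= p)%E.
    apply: le_ereal_inf_tmp => _ [C /ph/(hardy_gt0 a0 tb) C0 <-].
    by rewrite lee_fin ltW.
  pose C0 := a * \int[mu]_(x in `]0, a[) D x.
  have poo : (p <= C0%:E)%E.
    apply: ereal_inf_lbound; eexists; last reflexivity.
    exact/hp/hardy_finite.
  exists (fine p); rewrite fineK // ge0_fin_numE //.
  by apply: le_lt_trans poo _; exact: ltry.
rewrite cE.
have [pc _] := poincare_constant_min mU mH (partition_function_pos a0 mH H_even tb) cE.
have hc := ph c pc.
have c0 := hardy_gt0 a0 tb hc.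
pose m := boltzmann H (gamma - beta).
have wmE : boltzmann H gamma = fun x => boltzmann H beta x * m x.
  apply/funext => x; rewrite /m /boltzmann -expRD; congr expR; ring.
have mm : measurable_fun `]0, a[ m.
  apply: measurable_funS (measurable_boltzmann (gamma - beta) mH) => //.
  by apply: subset_itvr; rewrite bnd_simp oppr_le0 ltW.
have m0 x : 0 < x < a -> 0 < m x by move=> _; exact: expR_gt0.
have mni y x : 0 < y -> y <= x -> x < a -> m x <= m y.
  by move=> y0 yx xa; rewrite ler_expR lerN2; exact: mono.
have m12 : m t2 < m t1 by rewrite ltr_expR ltrN2.
have twm : tame a (fun x => boltzmann H beta x * m x) D' by rewrite -wmE.
pose k := tail_mass a t2 (boltzmann H beta) * (m t1 - m t2).
have t20 : 0 < t2 by apply: lt_trans t12.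
have k0 : 0 < k by rewrite mulr_gt0 ?subr_gt0 // (tail_mass_gt0 tb).
have gain (g : R -> R) : measurable_fun `]0, a[ g -> (forall x, 0 <= g x) ->
    mu.-integrable `]0, a[ (EFin \o (fun x => g x ^+ 2 * (boltzmann H beta x * m x))) ->
    \int[mu]_(x in `]0, a[) (primitive g x ^+ 2 * (boltzmann H beta x * m x)) + k * primitive g t1 ^+ 2 <=
    c * \int[mu]_(x in `]0, a[) (g x ^+ 2 * (boltzmann H beta x * m x)).
  move=> mg g0 ig.
  have -> : k * primitive g t1 ^+ 2 =
    primitive g t1 ^+ 2 * tail_mass a t2 (boltzmann H beta) * (m t1 - m t2).
    by rewrite /k; ring.
  have gain0 := hardy_gain tb mm m0 mni twm (ltW c0) hc t10 t12 t2a mg g0 ig.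
  rewrite /tail_mass; exact: gain0.
have [d d0 hd] := hardy_strict t10 (lt_trans t12 t2a) twm k0 gain.
apply: (@le_lt_trans _ _ (c - d)%:E); last by rewrite lte_fin gtrBl.
apply: ereal_inf_lbound; exists (c - d); last reflexivity.
by apply: (poincare_of_hardy a0 mH H_even tg); rewrite wmE.
Qed.

Hypothesis Z_finite : forall beta : R, 0 <= beta ->
  (partition_function `](- a)%R, a[%classic H beta < +oo)%E.

Lemma boltzmann_integrable beta : 0 <= beta ->
  mu.-integrable `]0, a[ (EFin \o boltzmann H beta).
Proof.
move=> b0.
have : mu.-integrable `]- a, a[ (EFin \o boltzmann H beta).
  apply/integrableP; split.
    by apply/measurable_EFinP; exact: measurable_boltzmann.
  apply: le_lt_trans (Z_finite b0); rewrite le_eqVlt; apply/orP; left; apply/eqP.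
  by apply: eq_integral => x _; rewrite /= ger0_norm // expR_ge0.
by apply: integrableS => //; apply: subset_itvr; rewrite bnd_simp oppr_le0 ltW.
Qed.

Lemma measurable_boltzmann_half beta : measurable_fun `]0, a[ (boltzmann H beta).
Proof.
apply: measurable_funS (measurable_boltzmann beta mH) => //.
by apply: subset_itvr; rewrite bnd_simp oppr_le0 ltW.
Qed.

Lemma tame_nondecreasing beta : 0 <= beta ->
  (forall y x, 0 <= y -> y <= x -> x < a -> H y <= H x) ->
  tame a (boltzmann H beta) (fun=> 1).
Proof.
move=> b0 Hmono; split.
- exact: measurable_boltzmann_half.
- by move=> x _; exact: expR_gt0.
- exact: boltzmann_integrable.
- exact: integrable_cst_itv.
- move=> y x y0 yx xa; rewrite mul1r ler_expR lerN2 ler_wpM2l //.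
  by apply: Hmono => //; exact: ltW.
Qed.

Lemma tame_nonincreasing beta : 0 <= beta ->
  (forall y x, 0 <= y -> y <= x -> x < a -> H x <= H y) ->
  tame a (boltzmann H beta) (fun x => (boltzmann H beta 0)^-1 * boltzmann H beta x).
Proof.
move=> b0 Hmono; split.
- exact: measurable_boltzmann_half.
- by move=> x _; exact: expR_gt0.
- exact: boltzmann_integrable.
- by apply: integrable_scale; [exact: measurable_itv|exact: boltzmann_integrable].
- move=> y x y0 yx xa; have r0 : 0 < boltzmann H beta 0 by exact: expR_gt0.
  rewrite mulrAC mulrC ler_peMr ?expR_ge0 // ler_pdivlMl // mulr1.
  rewrite ler_expR lerN2 ler_wpM2l //; apply: Hmono => //; first exact: ltW.
  exact: le_lt_trans xa.
Qed.

(** If [H] were constant on [(0, a)], it would be constant on [(-a, a)] by evenness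
    and by continuity at 0. *)
Lemma nonconstant_half :
  ~ (exists c, forall x, - a < x < a -> H x = c) ->
  exists t1 t2, [/\ 0 < t1, t1 < t2, t2 < a & H t1 != H t2].
Proof.
move=> nc; apply: contrapT => nt; apply: nc.
have eqH t1 t2 : 0 < t1 -> t1 < t2 -> t2 < a -> H t1 = H t2.
  by move=> t10 t12 t2a; apply/eqP; apply: contrapT => /negP ne; apply: nt; exists t1, t2.
pose b := a / 2; have [b0 ba] : 0 < b /\ b < a by rewrite /b; move: a0; split; lra.
have pos x : 0 < x < a -> H x = H b.
  move=> /andP[x0 xa]; have [xb|bx|-> //] := ltgtP x b; first exact: eqH.
  by rewrite (eqH b x).
exists (H b) => x /andP[ax xa].
have [x0|x0|->] := ltgtP x 0.
- by rewrite -H_even ?ax // pos // oppr_gt0 x0 ltrNl.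
- by rewrite pos // x0.
have H0 : {for 0, continuous H}.
  have := cH; rewrite continuous_open_subspace; last exact: interval_open.
  by apply; rewrite inE /= in_itv /= oppr_lt0 a0.
have := cvg_at_right_filter H0 => {}H0.
have Hb : H x @[x --> 0^'+] --> H b.
  apply: cvg_near_cst; near=> y; apply: pos; apply/andP; split; near: y.
    exact: nbhs_right_gt.
  exact: nbhs_right_lt.
exact: (cvg_unique _ H0 Hb).
Unshelve. all: by end_near. Qed.

End comparison.

Lemma piecewise_C1_nondecreasing {R : realType} (a : R) (H : R -> R) (K : set R) :
  {within `]- a, a[, continuous H} -> finite_set K ->
  (forall x, 0 < x < a -> ~ K x -> derivable H x 1 /\ 0 <= derive1 H x) ->
  forall y x, 0 <= y -> y <= x -> x < a -> H y <= H x.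
Proof.
move=> cH /finite_seqP[s KE] dH y x y0 yx xa.
apply: (nondecreasing_off_finite (s := s)) => //.
  apply: continuous_subspaceW cH => z /=; rewrite !in_itv /= => /andP[yz zx].
  by rewrite (le_lt_trans zx xa) andbT (lt_le_trans _ yz) // (lt_le_trans _ y0) // oppr_lt0 (le_lt_trans y0) // (le_lt_trans yx).
move=> z /andP[yz zx] zs; apply: dH; first by rewrite (le_lt_trans y0 yz) (lt_trans zx).
by rewrite KE /= (negbTE zs).
Qed.

Theorem theorem1p4 (R : realType) (a : R) (H : R -> R) (K : set R)
    (a_gt0 : 0 < a)
    (H_nonconstant : ~ exists c : R, forall x : R, - a < x < a -> H x = c)
    (H_even : forall x : R, - a < x < a -> H (- x) = H x)
    (H_pwC1 : piecewise_C1 `]- a, a[%classic K H)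
    (Z_finite : forall beta : R, 0 <= beta ->
       (partition_function `](- a)%R, a[%classic H beta < +oo)%E) :
  ((forall x : R, 0 < x < a -> ~ K x -> 0 <= derive1 H x) ->
   forall beta1 beta2 : R, 0 <= beta1 -> beta1 < beta2 ->
     (poincare_constant `](- a)%R, a[%classic H beta2
      < poincare_constant `](- a)%R, a[%classic H beta1)%E) /\
  ((forall x : R, 0 < x < a -> ~ K x -> derive1 H x <= 0) ->
   forall beta1 beta2 : R, 0 <= beta1 -> beta1 < beta2 ->
     (poincare_constant `](- a)%R, a[%classic H beta1
      < poincare_constant `](- a)%R, a[%classic H beta2)%E).
Proof.
have [cH [finK _] dH _ _] := H_pwC1.
have dH' x : 0 < x < a -> ~ K x -> derivable H x 1.
  move=> /andP[x0 xa] Kx; apply: dH; split => //.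
  by rewrite /= in_itv /= xa (lt_trans _ x0) // oppr_lt0.
have [t1 [t2 [t10 t12 t2a Ht]]] := nonconstant_half a_gt0 cH H_even H_nonconstant.
split=> H' beta1 beta2 b10 b12; have b20 : 0 <= beta2 by rewrite ltW // (le_lt_trans b10).
- have mono := piecewise_C1_nondecreasing cH finK
    (fun x xa Kx => conj (dH' x xa Kx) (H' x xa Kx)).
  have tame1 := tame_nondecreasing a_gt0 cH Z_finite b10 mono.
  have tame2 := tame_nondecreasing a_gt0 cH Z_finite b20 mono.
  apply: (poincare_constant_lt a_gt0 cH H_even tame1 tame2 _ t10 t12 t2a).
  + move=> y x y0 yx xa; rewrite ler_pM2l ?subr_gt0 //.
    by apply: mono => //; exact: ltW.
  + by rewrite ltr_pM2l ?subr_gt0 // lt_neqAle Ht mono // ltW.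
(* now the weight at beta1 is the one at beta2 times a nonincreasing factor *)
- have cN : {within `]- a, a[, continuous (fun x => - H x)}.
    by move=> x; apply: cvgN; exact: cH.
  have monoN : forall y x, 0 <= y -> y <= x -> x < a -> - H y <= - H x.
    apply: (piecewise_C1_nondecreasing cN finK) => x xa Kx.
    have dx := dH' x xa Kx; split; first exact: derivableN.
    by rewrite derive1E deriveN // -derive1E oppr_ge0 H'.
  have mono y x : 0 <= y -> y <= x -> x < a -> H x <= H y.
    by move=> y0 yx xa; rewrite -lerN2 monoN.
  have tame1 := tame_nonincreasing a_gt0 cH Z_finite b10 mono.
  have tame2 := tame_nonincreasing a_gt0 cH Z_finite b20 mono.
  apply: (poincare_constant_lt a_gt0 cH H_even tame2 tame1 _ t10 t12 t2a).
  + move=> y x y0 yx xa; rewrite ler_nM2l ?subr_lt0 //.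
    by apply: mono => //; exact: ltW.
  + by rewrite ltr_nM2l ?subr_lt0 // lt_neqAle eq_sym Ht mono // ltW.
Qed.
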